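(* Let $Q$ be a finite loop and let $x\in Q$ be such that $P(Q)\subseteq xQ'$. Then $P(Q)\cap yA(Q)\neq\emptyset$ for all $y\in xQ'$; that is, $P(Q)$ intersects every coset of $A(Q)$ contained in $xQ'$. In particular, if $P(Q)\subseteq Q'$, then $P(Q)$ intersects $A(Q)$. Moreover, for every $k\geq 1$, $P^k(Q)$ also intersects every coset of $A(Q)$ contained in the coset of $Q'$ that contains $P^k(Q)$.
   Context: A loop is a set $Q$ with a binary operation and a neutral element $1$ such that for all $x,z\in Q$ the equations $x\cdot y_1=z$ and $y_2\cdot x=z$ have unique solutions $y_1,y_2\in Q$. All loops are finite. Write $L_x(y)=xy$ and $R_x(y)=yx$. The inner mappings of $Q$ are $L(x,y)=L_{yx}^{-1}L_yL_x$, $R(x,y)=R_{xy}^{-1}R_yR_x$ and $T(x)=R_x^{-1}L_x$. A subloop is normal if it is invariant under all inner mappings. The associator subloop $A(Q)$ is the smallest normal subloop of $Q$ such that $Q/A(Q)$ is a group. The derived subloop $Q'$ is the smallest normal subloop of $Q$ such that $Q/Q'$ is an Abelian group. One has $A(Q)\subseteq Q'$, so cosets of $Q'$ are partitioned by cosets of $A(Q)$. For $k\ge 1$, $P^k(Q)$ is the set of elements of $Q$ that can be written as a product (in some order and with some association/bracketing) in which every element of $Q$ occurs as a factor precisely $k$ times; $P(Q)=P^1(Q)$. The set $P^k(Q)$ is always contained in a single coset of $Q'$. *)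

(* Defs.v *)
From HB Require Import structures.
From mathcomp Require Import ssreflect ssrfun ssrbool eqtype ssrnat seq choice.
From mathcomp Require Import fintype bigop finset fingroup perm.

Set Implicit Arguments.
Unset Strict Implicit.
Unset Printing Implicit Defensive.

HB.mixin Record isLoop Q := {
  loop_mul : Q -> Q -> Q;
  loop_one : Q;
  loop_mul1l : left_id loop_one loop_mul;
  loop_mul1r : right_id loop_one loop_mul;
  loop_ldiv : forall x z : Q, exists! y, loop_mul x y = z;
  loop_rdiv : forall x z : Q, exists! y, loop_mul y x = z
}.

#[short(type="finLoopType")]
HB.structure Definition FinLoop := {Q of Finite Q & isLoop Q}.

Declare Scope loop_scope.
Delimit Scope loop_scope with L.
Bind Scope loop_scope with FinLoop.sort.
Notation "x * y" := (loop_mul x y) : loop_scope.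
Notation "1" := loop_one : loop_scope.
Local Open Scope loop_scope.

Section LoopDefs.

Variable Q : finLoopType.
Implicit Types (x y z a : Q) (N S : {set Q}).

Lemma loop_mulI x : injective (fun y => x * y).
Proof.
move=> y z /= e; have [w [_ uw]] := loop_ldiv x (x * z).
by rewrite -(uw z (erefl _)) -(uw y e).
Qed.

Lemma loop_mulIr x : injective (fun y => y * x).
Proof.
move=> y z /= e; have [w [_ uw]] := loop_rdiv x (z * x).
by rewrite -(uw z (erefl _)) -(uw y e).
Qed.

Definition Lmul x : {perm Q} := perm (@loop_mulI x).
Definition Rmul x : {perm Q} := perm (@loop_mulIr x).

(* Inner mappings, applied pointwise: the composites act right to left, whereas
   the product of {perm Q} acts left to right. *)
Definition innerL x y z : Q := (Lmul (y * x))^-1%g (Lmul y (Lmul x z)).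
Definition innerR x y z : Q := (Rmul (x * y))^-1%g (Rmul y (Rmul x z)).
Definition innerT x z : Q := (Rmul x)^-1%g (Lmul x z).

(* (Lmul x)^-1 y and (Rmul x)^-1 y are the solutions u of x * u = y and
   u * x = y. *)
Definition subloop S : bool :=
  (1 \in S) &&
  [forall x in S, forall y in S,
    [&& x * y \in S, (Lmul x)^-1%g y \in S & (Rmul x)^-1%g y \in S]].

Definition normal_subloop N : bool :=
  [&& subloop N,
      [forall x, forall y, forall z in N,
         (innerL x y z \in N) && (innerR x y z \in N)] &
      [forall x, forall z in N, innerT x z \in N]].

Definition loop_coset x S : {set Q} := [set x * s | s in S].
Definition loop_cosets S : {set {set Q}} := [set loop_coset x S | x in Q].

(* For N normal, (x N)(y N) = (x y) N; see loop_cosetM. *)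
Definition coset_mul (X Y : {set Q}) : {set Q} := [set x * y | x in X, y in Y].

End LoopDefs.

Definition is_group (T : finType) (op : T -> T -> T) (e : T) (G : {set T}) :
    bool :=
  [&& e \in G,
      [forall x in G, forall y in G, op x y \in G],
      [forall x in G, forall y in G, forall z in G,
         op x (op y z) == op (op x y) z],
      [forall x in G, (op e x == x) && (op x e == x)] &
      [forall x in G, exists y in G, (op x y == e) && (op y x == e)]].

Definition is_abelian_group (T : finType) (op : T -> T -> T) (e : T)
    (G : {set T}) : bool :=
  is_group op e G && [forall x in G, forall y in G, op x y == op y x].

Section AssociatorDerived.

Variable Q : finLoopType.
Implicit Types (x y z : Q) (N M : {set Q}).

Definition group_quotient N : bool :=
  is_group (@coset_mul Q) N (loop_cosets N).

Definition abelian_quotient N : bool :=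
  is_abelian_group (@coset_mul Q) N (loop_cosets N).

(* The intersections below are themselves normal with a group, resp. an Abelian
   group, as quotient, and so are the smallest such subloops: see
   associator_subloop_smallest and derived_subloop_smallest. *)
Definition associator_subloop : {set Q} :=
  \bigcap_(N | normal_subloop N && group_quotient N) N.

Definition derived_subloop : {set Q} :=
  \bigcap_(N | normal_subloop N && abelian_quotient N) N.

End AssociatorDerived.

Arguments associator_subloop Q : clear implicits.
Arguments derived_subloop Q : clear implicits.

Inductive bracketing (T : Type) : Type :=
| Factor of T
| Prod of bracketing T & bracketing T.

Fixpoint factors (T : Type) (t : bracketing T) : seq T :=
  match t with
  | Factor x => [:: x]
  | Prod t1 t2 => factors t1 ++ factors t2
  end.

Fixpoint bracket_value (Q : finLoopType) (t : bracketing Q) : Q :=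
  match t with
  | Factor x => x
  | Prod t1 t2 => bracket_value t1 * bracket_value t2
  end.

(* Membership in P^k(Q). *)
Definition full_product (Q : finLoopType) (k : nat) (p : Q) : Prop :=
  exists t : bracketing Q,
    (forall x : Q, count_mem x (factors t) = k) /\ bracket_value t = p.

Section Smallest.

Variable Q : finLoopType.
Implicit Types (x y z : Q) (N M : {set Q}).

Lemma LmulE x y : Lmul x y = x * y. Proof. by rewrite permE. Qed.
Lemma RmulE x y : Rmul x y = y * x. Proof. by rewrite permE. Qed.
Lemma LmulVK x y : x * (Lmul x)^-1%g y = y. Proof. by rewrite -LmulE permKV. Qed.
Lemma RmulVK x y : (Rmul x)^-1%g y * x = y. Proof. by rewrite -RmulE permKV. Qed.
Lemma LmulKV x y : (Lmul x)^-1%g (x * y) = y. Proof. by rewrite -LmulE permK. Qed.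
Lemma RmulKV x y : (Rmul x)^-1%g (y * x) = y. Proof. by rewrite -RmulE permK. Qed.

Lemma mem_loop_coset x y N : (y \in loop_coset x N) = ((Lmul x)^-1%g y \in N).
Proof.
apply/imsetP/idP => [[n nN ->]|yN]; first by rewrite LmulKV.
by exists ((Lmul x)^-1%g y); rewrite // LmulVK.
Qed.

Lemma subloopP N :
  reflect [/\ 1 \in N,
            forall x y, x \in N -> y \in N -> x * y \in N,
            forall x y, x \in N -> y \in N -> (Lmul x)^-1%g y \in N &
            forall x y, x \in N -> y \in N -> (Rmul x)^-1%g y \in N]
          (subloop N).
Proof.
apply: (iffP andP) => [[N1 /forall_inP h]|[N1 hM hL hR]].
  by split=> // x y /h/forall_inP hx /hx/and3P[].
split=> //; apply/forall_inP => x xN; apply/forall_inP => y yN.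
by rewrite hM // hL // hR.
Qed.

Lemma normal_subloopP N :
  reflect [/\ subloop N,
            forall x y z, z \in N -> innerL x y z \in N,
            forall x y z, z \in N -> innerR x y z \in N &
            forall x z, z \in N -> innerT x z \in N]
          (normal_subloop N).
Proof.
apply: (iffP and3P) => [[sN /forallP h /forallP hT]|[sN hL hR hT]].
  split=> // [x y z zN|x y z zN|x z zN].
  - by have /forallP/(_ y)/forall_inP/(_ z zN)/andP[] := h x.
  - by have /forallP/(_ y)/forall_inP/(_ z zN)/andP[] := h x.
  - by have /forall_inP/(_ z zN) := hT x.
split=> //; apply/forallP => x; last by apply/forall_inP => z; apply: hT.
by apply/forallP => y; apply/forall_inP => z zN; rewrite hL // hR.
Qed.

Lemma inner_surj N (f : Q -> Q) : injective f ->
  (forall z, z \in N -> f z \in N) ->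
  forall z, z \in N -> exists2 w, w \in N & f w = z.
Proof.
move=> fI fN z zN; have sub : f @: N \subset N.
  by apply/subsetP => _ /imsetP[w wN ->]; apply: fN.
have /eqP E : f @: N == N by rewrite eqEcard sub card_imset /=.
by move: zN; rewrite -{1}E => /imsetP[w wN ->]; exists w.
Qed.

Arguments subloopP {N}.
Arguments normal_subloopP {N}.

Section NormalCosets.

Variable N : {set Q}.
Hypothesis nN : normal_subloop N.

Lemma mulLN x y n : n \in N -> exists2 m, m \in N & y * (x * n) = (y * x) * m.
Proof.
have [_ hL _ _] := normal_subloopP nN => nn.
by exists (innerL x y n); [exact: hL | rewrite LmulVK !LmulE].
Qed.

Lemma mulLN' x y n : n \in N -> exists2 m, m \in N & (y * x) * n = y * (x * m).
Proof.
have [_ hL _ _] := normal_subloopP nN => nn.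
have [|m mN <-] := inner_surj _ (hL x y) nn; last first.
  by exists m => //; rewrite LmulVK !LmulE.
by move=> u v /perm_inj/perm_inj/perm_inj.
Qed.

Lemma mulNR x y n : n \in N -> exists2 m, m \in N & (n * x) * y = m * (x * y).
Proof.
have [_ _ hR _] := normal_subloopP nN => nn.
by exists (innerR x y n); [exact: hR | rewrite RmulVK !RmulE].
Qed.

Lemma mulNC x n : n \in N -> exists2 m, m \in N & x * n = m * x.
Proof.
have [_ _ _ hT] := normal_subloopP nN => nn.
by exists (innerT x n); [exact: hT | rewrite RmulVK LmulE].
Qed.

Lemma mulNC' x n : n \in N -> exists2 m, m \in N & n * x = x * m.
Proof.
have [_ _ _ hT] := normal_subloopP nN => nn.
have [|m mN <-] := inner_surj _ (hT x) nn; last first.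
  by exists m => //; rewrite RmulVK LmulE.
by move=> u v /perm_inj/perm_inj.
Qed.

Lemma loop_cosetM x y :
  coset_mul (loop_coset x N) (loop_coset y N) = loop_coset (x * y) N.
Proof.
have /subloopP[N1 NM _ _] : subloop N by case: (normal_subloopP nN).
apply/setP => z; apply/imset2P/imsetP.
  case=> _ _ /imsetP[n nn ->] /imsetP[m mm ->] ->.
  have [a aN ->] := mulLN y (x * n) mm.
  have [b bN ->] := mulNC x nn.
  have [c cN ->] := mulNR x y bN.
  have [d dN ->] := mulNC' (x * y) cN.
  have [e eN ->] := mulLN' d (x * y) aN.
  by exists (d * e); rewrite // NM.
case=> n nn ->; have [m mm ->] := mulLN' y x nn.
exists x (y * m); rewrite ?imset_f //.
by apply/imsetP; exists 1; rewrite ?loop_mul1r.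
Qed.

Lemma loop_cosetP x y :
  (loop_coset y N == loop_coset x N) = ((Lmul x)^-1%g y \in N).
Proof.
have /subloopP[N1 NM NV _] : subloop N by case: (normal_subloopP nN).
rewrite -mem_loop_coset; apply/eqP/idP => [<-|/imsetP[n nn ->]].
  by apply/imsetP; exists 1; rewrite ?loop_mul1r.
apply/setP => z; apply/imsetP/imsetP => -[m mm ->].
  by have [a aN ->] := mulLN' n x mm; exists (n * a); rewrite ?NM.
have [a aN E] := mulLN n x (NV n m nn mm).
by exists a; rewrite // -E LmulVK.
Qed.

Lemma loop_coset1 : loop_coset 1 N = N.
Proof. by apply/setP => z; rewrite mem_loop_coset -{1}(loop_mul1l z) LmulKV. Qed.

Lemma group_quotientP :
  reflect (forall x y z, (Lmul (x * (y * z)))^-1%g ((x * y) * z) \in N)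
          (group_quotient N).
Proof.
apply: (iffP idP) => [/and5P[_ _ /forall_inP hA _ _] x y z|hA].
  have inC u : loop_coset u N \in loop_cosets N by apply: imset_f.
  rewrite -loop_cosetP -!loop_cosetM.
  have /forall_inP/(_ _ (inC y))/forall_inP/(_ _ (inC z)) := hA _ (inC x).
  by rewrite eq_sym.
have hA' x y z : loop_coset (x * (y * z)) N = loop_coset ((x * y) * z) N.
  by apply/esym/eqP; rewrite loop_cosetP.
apply/and5P; split.
- by apply/imsetP; exists 1; rewrite ?loop_coset1.
- apply/forall_inP => _ /imsetP[x _ ->]; apply/forall_inP => _ /imsetP[y _ ->].
  by rewrite loop_cosetM; apply: imset_f.
- apply/forall_inP => _ /imsetP[x _ ->]; apply/forall_inP => _ /imsetP[y _ ->].
  by apply/forall_inP => _ /imsetP[z _ ->]; rewrite !loop_cosetM hA'.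
- apply/forall_inP => _ /imsetP[x _ ->].
  have := loop_cosetM 1 x; have := loop_cosetM x 1.
  by rewrite loop_coset1 loop_mul1l loop_mul1r => -> ->; rewrite !eqxx.
apply/forall_inP => _ /imsetP[x _ ->].
pose r := (Lmul x)^-1%g 1; pose l := (Rmul x)^-1%g 1.
have xr : x * r = 1 by rewrite LmulVK.
have lx : l * x = 1 by rewrite RmulVK.
have lr : loop_coset l N = loop_coset r N.
  by have := hA' l x r; rewrite xr lx loop_mul1l loop_mul1r.
apply/exists_inP; exists (loop_coset r N); first exact: imset_f.
by rewrite -{2}lr !loop_cosetM xr lx loop_coset1 eqxx.
Qed.

Lemma abelian_quotientP :
  reflect ((forall x y z, (Lmul (x * (y * z)))^-1%g ((x * y) * z) \in N) /\
           forall x y, (Lmul (y * x))^-1%g (x * y) \in N)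
          (abelian_quotient N).
Proof.
apply: (iffP andP) => [[/group_quotientP hA /forall_inP hC]|[hA hC]].
  split=> // x y; have inC u : loop_coset u N \in loop_cosets N by apply: imset_f.
  rewrite -loop_cosetP -!loop_cosetM.
  by have /forall_inP/(_ _ (inC y)) := hC _ (inC x).
split; first exact/group_quotientP.
apply/forall_inP => _ /imsetP[x _ ->]; apply/forall_inP => _ /imsetP[y _ ->].
by rewrite !loop_cosetM loop_cosetP.
Qed.

End NormalCosets.

Lemma normal_subloop_bigcap (P : pred {set Q}) :
  (forall N, P N -> normal_subloop N) -> normal_subloop (\bigcap_(N | P N) N).
Proof.
move=> PN; apply/normal_subloopP; split.
- apply/subloopP; split.
  + by apply/bigcapP => N /PN/normal_subloopP[/subloopP[]].
  + move=> x y /bigcapP hx /bigcapP hy; apply/bigcapP => N PNN.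
    have /normal_subloopP[/subloopP[_ h _ _] _ _ _] := PN _ PNN.
    by apply: h; auto.
  + move=> x y /bigcapP hx /bigcapP hy; apply/bigcapP => N PNN.
    have /normal_subloopP[/subloopP[_ _ h _] _ _ _] := PN _ PNN.
    by apply: h; auto.
  + move=> x y /bigcapP hx /bigcapP hy; apply/bigcapP => N PNN.
    have /normal_subloopP[/subloopP[_ _ _ h] _ _ _] := PN _ PNN.
    by apply: h; auto.
- move=> x y z /bigcapP hz; apply/bigcapP => N PNN.
  by have /normal_subloopP[_ h _ _] := PN _ PNN; apply: h; auto.
- move=> x y z /bigcapP hz; apply/bigcapP => N PNN.
  by have /normal_subloopP[_ _ h _] := PN _ PNN; apply: h; auto.
- move=> x z /bigcapP hz; apply/bigcapP => N PNN.
  by have /normal_subloopP[_ _ _ h] := PN _ PNN; apply: h; auto.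
Qed.

Lemma associator_subloop_smallest :
  [/\ normal_subloop (associator_subloop Q),
      group_quotient (associator_subloop Q) &
      forall N, normal_subloop N -> group_quotient N ->
        associator_subloop Q \subset N].
Proof.
have nA : normal_subloop (associator_subloop Q).
  by apply: normal_subloop_bigcap => N /andP[].
split=> // [|N nN gN]; last by apply: bigcap_inf; rewrite nN.
apply/(group_quotientP nA) => x y z; apply/bigcapP => N /andP[nN].
by move/(group_quotientP nN).
Qed.

Lemma derived_subloop_smallest :
  [/\ normal_subloop (derived_subloop Q),
      abelian_quotient (derived_subloop Q) &
      forall N, normal_subloop N -> abelian_quotient N ->
        derived_subloop Q \subset N].
Proof.
have nD : normal_subloop (derived_subloop Q).
  by apply: normal_subloop_bigcap => N /andP[].
split=> // [|N nN gN]; last by apply: bigcap_inf; rewrite nN.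
apply/(abelian_quotientP nD); split=> [x y z|x y]; apply/bigcapP => N /andP[nN].
  by move/(abelian_quotientP nN) => [].
by move/(abelian_quotientP nN) => [].
Qed.

End Smallest.

(* Main.v *)
(** Right translations of the cosets turn [Q / A(Q)] into a finite group [G], and
    a product over [Q] is sent to a product in [G] in which every element occurs
    a constant number of times.  So everything reduces to the theorem of Denes
    and Hermann: the products of all elements of a finite group [G], taken in
    all orders, fill a coset of [G'].

    By induction it is enough to find a normal subgroup [K <> 1] of [G] and a
    list of distinct elements, avoiding at least one element of every coset of
    [K], whose products fill a coset of [K]: the remaining elements are then
    handled in [G / K].
    - If [z = [x, y] <> 1] is central, of prime order [p] after replacing [x] by
      a power, use the pairs [x z^i], [y z^i] for [0 < i < p]: each can be
      multiplied in two orders, which differ by [z].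
    - If [G] is solvable but not abelian and no such commutator exists, there is
      an elementary abelian normal [K] with [[K, G] = K]; moving elements of [K]
      along a fixed word in representatives of [G / K] multiplies the product by
      commutators.
    - If [G] is not solvable, it has a perfect normal subgroup [K <> 1], and the
      products of a perfect group [K] are all of [K].  Indeed, build random words by
      placing each new letter in front or at the back.  Nontrivial characters of
      [K] have degree at least 2, and degree 2 forces [#|K| >= 120], degrees at
      least 3 force [#|K| >= 60]; hence the collision probability of the products
      decays so fast that two disjoint sets of letters reach, together, more
      than [#|K|] products, and then every element of [K] is a product of one
      from each. *)

Require Import Defs.
From mathcomp Require Import ssreflect ssrfun ssrbool eqtype ssrnat seq choice.
From mathcomp Require Import fintype bigop finset.
From mathcomp Require Import all_boot all_order all_algebra all_fingroup.
From mathcomp Require Import all_solvable all_field all_character.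
From mathcomp Require Import zify ring.

Set Implicit Arguments.
Unset Strict Implicit.
Unset Printing Implicit Defensive.

Import Order.TTheory GRing.Theory Num.Theory.

(** * Permuting, splitting and completing sequences *)

Lemma perm_eq_map_lift (T1 T2 : eqType) (f : T1 -> T2) s t :
  perm_eq t (map f s) -> exists2 s', perm_eq s' s & t = map f s'.
Proof.
elim: t s => [|y t IH] s p.
  by exists [::]; move: p; rewrite // perm_sym => /perm_nilP; case: s.
have : y \in map f s by rewrite -(perm_mem p) mem_head.
case/mapP=> x xs ey; have [|s' ps' et] := IH (rem x s).
  by rewrite -(perm_cons y) (permPl p) ey -map_cons perm_map // perm_to_rem.
exists (x :: s'); last by rewrite /= ey et.
by rewrite (permPr (perm_to_rem xs)) perm_cons.
Qed.

Lemma perm_uniq_sub (T : eqType) (a b : seq T) :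
  uniq a -> {subset a <= b} -> exists r, perm_eq b (a ++ r).
Proof.
elim: a b => [|x a IH] b /=; first by exists b.
case/andP=> xa ua sab; have xb : x \in b by apply: sab; rewrite mem_head.
have [|r p] := IH (rem x b) ua.
  move=> y ya; have : y \in x :: rem x b.
    by rewrite -(perm_mem (perm_to_rem xb)) sab // inE ya orbT.
  by rewrite inE => /predU1P[e|//]; rewrite -e ya in xa.
by exists r; rewrite (permPl (perm_to_rem xb)) perm_cons.
Qed.

Lemma filter_eq_cat (T : Type) (a : pred T) (w s1 s2 : seq T) :
  filter a w = s1 ++ s2 ->
  exists w1 w2, [/\ w = w1 ++ w2, filter a w1 = s1 & filter a w2 = s2].
Proof.
elim: w s1 => [|x w IH] s1 /=.
  by case: s1 => //= <-; exists [::], [::].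
case: ifP => ax; last first.
  by case/IH=> w1 [w2 [-> <- <-]]; exists (x :: w1), w2; rewrite /= ax.
case: s1 => [|y s1] /=.
  by move=> <-; exists [::], (x :: w); rewrite /= ax.
by case=> <- /IH[w1 [w2 [-> <- <-]]]; exists (x :: w1), w2; rewrite /= ax.
Qed.

Lemma perm_cat_complement (T : finType) (A : {pred T}) (s : seq T) :
  uniq s -> {subset s <= A} -> perm_eq (s ++ [seq x <- enum A | x \notin s]) (enum A).
Proof.
move=> us sA; apply: uniq_perm; rewrite ?enum_uniq //.
  rewrite cat_uniq us filter_uniq ?enum_uniq // andbT.
  by apply/hasPn=> x; rewrite mem_filter => /andP[].
move=> x; rewrite mem_cat mem_filter mem_enum.
by case: (boolP (x \in s)) => //= /sA ->.
Qed.

(** * Products of a sequence in all orders *)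

Section OrderedProducts.
Local Open Scope group_scope.
Variable gT : finGroupType.
Implicit Types (s : seq gT) (g h x : gT) (N : {set gT}).

Definition ordprods s : {set gT} :=
  [set g in [seq \prod_(x <- s') x | s' <- permutations s]].

Definition covers s N := exists g, g *: N \subset ordprods s.

Lemma ordprodsP s g :
  reflect (exists2 s', perm_eq s' s & g = \prod_(x <- s') x) (g \in ordprods s).
Proof.
rewrite inE; apply: (iffP mapP) => -[s' ps ->]; exists s' => //.
  by rewrite mem_permutations in ps.
by rewrite mem_permutations.
Qed.

Lemma mem_ordprods s : \prod_(x <- s) x \in ordprods s.
Proof. by apply/ordprodsP; exists s. Qed.

Lemma perm_ordprods s1 s2 : perm_eq s1 s2 -> ordprods s1 = ordprods s2.
Proof.
move=> ps; apply/setP=> g; apply/ordprodsP/ordprodsP => -[s' p ->]; exists s' => //.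
  exact: perm_trans p ps.
by rewrite perm_sym in ps; exact: perm_trans p ps.
Qed.

Lemma perm_covers s1 s2 N : perm_eq s1 s2 -> covers s1 N -> covers s2 N.
Proof. by move=> ps; rewrite /covers (perm_ordprods ps). Qed.

Lemma ordprods_cat s1 s2 g1 g2 :
  g1 \in ordprods s1 -> g2 \in ordprods s2 -> g1 * g2 \in ordprods (s1 ++ s2).
Proof.
case/ordprodsP=> t1 p1 -> /ordprodsP[t2 p2 ->]; apply/ordprodsP.
by exists (t1 ++ t2); rewrite ?big_cat ?perm_cat.
Qed.

Lemma ordprods_cons1 s : ordprods (1 :: s) = ordprods s.
Proof.
apply/setP=> g; apply/ordprodsP/ordprodsP=> -[t p ->]; last first.
  by exists (1 :: t); rewrite ?perm_cons ?big_cons ?mul1g.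
have t1 : 1 \in t by rewrite (perm_mem p) mem_head.
case/splitPr: t / t1 p => t1 t2 p; exists (t1 ++ t2).
  rewrite -(perm_cons 1); apply: perm_trans p.
  by rewrite -[in X in perm_eq _ X]cat1s perm_sym perm_catCA.
by rewrite !big_cat big_cons /= mul1g.
Qed.

End OrderedProducts.

(** * Lifting products from a quotient group *)

Section Lifting.
Local Open Scope group_scope.

Variables (gT : finGroupType) (G N : {group gT}).
Hypothesis nNG : N <| G.
Implicit Types s : seq gT.

Lemma coset_prod s : {subset s <= G} ->
  \prod_(x <- map (coset N) s) x = coset N (\prod_(x <- s) x).
Proof.
elim: s => [|x s IH] sG; first by rewrite /= !big_nil morph1.
rewrite /= !big_cons IH => [|y ys]; last by apply: sG; rewrite inE ys orbT.
have sub := subsetP (normal_norm nNG).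
rewrite morphM ?sub //; first by apply: sG; rewrite mem_head.
by rewrite big_seq group_prod // => y ys; apply: sG; rewrite inE ys orbT.
Qed.

(** Some ordering of [s2] hits the wanted coset of [N] inside the coset of [M]; the discrepancy in
    [N] is then absorbed by reordering [s1]. *)
Lemma covers_cat_quotient s1 s2 (M : {group gT}) :
  N \subset M -> M \subset G -> {subset s2 <= G} ->
  covers s1 N -> covers (map (coset N) s2) (M / N) -> covers (s1 ++ s2) M.
Proof.
move=> sNM sMG s2G [g1 c1] [c c2].
have nNM := subset_trans sMG (normal_norm nNG).
have : c \in ordprods (map (coset N) s2).
  by apply: (subsetP c2); apply/lcosetP; exists 1; rewrite ?group1 ?mulg1.
case/ordprodsP=> t /perm_eq_map_lift[s ps ->] ec.
have sG : {subset s <= G} by move=> x; rewrite (perm_mem ps); apply: s2G.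
rewrite coset_prod // in ec; set g0 := \prod_(x <- s) x in ec.
have g0G : g0 \in G by rewrite /g0 big_seq group_prod // => x /sG.
exists (g1 * g0); apply/subsetP=> _ /lcosetP[h hM ->].
have nN x : x \in G -> x \in 'N(N) by apply: (subsetP (normal_norm nNG)).
have hG := subsetP sMG h hM.
have : coset N (g0 * h) \in ordprods (map (coset N) s2).
  apply: (subsetP c2); rewrite ec morphM ?nN //; apply/lcosetP.
  by exists (coset N h); rewrite ?mem_quotient.
case/ordprodsP=> t' /perm_eq_map_lift[s' ps' ->].
have sG' : {subset s' <= G} by move=> x; rewrite (perm_mem ps'); apply: s2G.
rewrite coset_prod //; set g2 := \prod_(x <- s') x => eg.
have g2G : g2 \in G by rewrite /g2 big_seq group_prod // => x /sG'.
have : g0 * h \in N :* g2.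
  by apply/rcoset_kercosetP; rewrite ?nN ?groupM.
case/rcosetP=> n nn e; rewrite -mulgA e mulgA ordprods_cat //.
  by apply: (subsetP c1); apply/lcosetP; exists n.
by apply/ordprodsP; exists s'.
Qed.

End Lifting.

(** * Collisions of random words *)

Section Energy.
Local Open Scope group_scope.
Local Open Scope ring_scope.
Variables (gT : finGroupType) (K : {group gT}).
Implicit Types (f : gT -> nat) (x u v g : gT) (i : Iirr K).
Local Notation n := (#|K|%:R : algC).

Definition mass f : nat := (\sum_(g in K) f g)%N.
Definition sqsum f : nat := (\sum_(g in K) f g ^ 2)%N.
(** For [x] in [K], the trace of rho(x) times the Fourier transform of [f] at the [i]-th irreducible
    representation rho; for unitary rho, [weight f i] is the squared Hilbert-Schmidt norm of that
    transform. *)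
Definition fourier f i x : algC := \sum_(u in K) (f u)%:R * 'chi_i (x * u)%g.
Definition weight f i : algC :=
  \sum_(u in K) \sum_(v in K) (f u)%:R * (f v)%:R * 'chi_i (v^-1 * u)%g.

(* Up to the factor #|K|, the squared L2 norm of the projection of f orthogonal
   to the constants, and of the class function obtained from it by averaging f
   over conjugacy classes. *)
Definition l2gap f : algC := n * (sqsum f)%:R - (mass f)%:R ^+ 2.
Definition classgap f : algC := \sum_(i | i != 0) `|fourier f i 1| ^+ 2.

(* If f counts words by their product, pushes x f counts the words x w and w x. *)
Definition pushes x f g := (f (x^-1 * g)%g + f (g * x^-1)%g)%N.

Lemma sum_conjg (F : gT -> algC) u : u \in K ->
  \sum_(x in K) F (u ^ x)%g = \sum_(v in (u ^: K)%g) #|'C_K[u]|%:R * F v.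
Proof.
move=> uK; rewrite (partition_big (fun x => u ^ x)%g (mem (u ^: K)%g)) /=; last first.
  by move=> x xK; rewrite memJ_class.
apply: eq_bigr => v /imsetP[y yK ->].
rewrite (eq_bigr (fun=> F (u ^ y)%g)) => [|x /andP[_ /eqP->]//].
rewrite sumr_const -[LHS]mulr_natl; congr (_%:R * _).
rewrite -(card_rcoset 'C_K[u]%g y); apply: eq_card => x.
rewrite unfold_in /= mem_rcoset inE groupMr ?groupV //.
congr (_ && _); apply/eqP/cent1P => [e|c].
  by apply/commute_sym/commgP/conjg_fixP; rewrite conjgM e conjgK.
by move/commute_sym/commgP/conjg_fixP: c; rewrite conjgM => /(canRL (conjgKV _)).
Qed.

(** Only conjugate pairs [u], [v] contribute, each with the factor [#|'C_K[u]|]: on the left it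
    counts conjugating elements, on the right it is the second orthogonality relation. *)
Lemma sum_fourier f :
  \sum_(x in K) \sum_(u in K) (f u)%:R * (f (x * u * x^-1)%g)%:R
  = \sum_i `|fourier f i 1| ^+ 2.
Proof.
transitivity (\sum_(u in K) \sum_(v in K) (f u)%:R * (f v)%:R
    * \sum_i 'chi[K]_i u * ('chi_i v)^*).
  rewrite exchange_big /=; apply: eq_bigr => u uK.
  rewrite (reindex_inj invg_inj) /=.
  rewrite (eq_big (mem K) (fun x => (f u)%:R * (f (u ^ x)%g)%:R)); last 2 first.
  - by move=> x; rewrite /= groupV.
  - by move=> x _; rewrite invgK conjgE mulgA.
  rewrite (sum_conjg (fun v => (f u)%:R * (f v)%:R)) //.
  rewrite [RHS](bigID (mem (u ^: K)%g)) /= [X in _ = _ + X]big1 ?addr0; last first.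
    move=> v /andP[vK vu]; rewrite second_orthogonality_relation //.
    by rewrite class_sym (negPf vu) mulr0.
  apply: eq_big => [v|v vu].
    by apply/idP/andP=> [vu|[]//]; split=> //; apply: (subsetP (class_subG uK _)) vu.
  rewrite second_orthogonality_relation ?(subsetP (class_subG uK _) v vu) //.
  by rewrite class_sym vu mulr1n; ring.
rewrite (eq_bigr (fun u => \sum_(i : Iirr K) \sum_(v in K)
    (f u)%:R * (f v)%:R * ('chi[K]_i u * ('chi_i v)^*))); last first.
  move=> u uK; rewrite exchange_big; apply: eq_bigr => v vK.
  by rewrite mulr_sumr.
rewrite exchange_big; apply: eq_bigr => i _.
rewrite normCK /fourier mulr_suml; apply: eq_bigr => u uK.
rewrite rmorph_sum mulr_sumr; apply: eq_bigr => v vK.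
by rewrite !mul1g rmorphM /= conjC_nat; ring.
Qed.

Lemma sum_fourier_shift f i :
  \sum_(x in K) `|fourier f i x| ^+ 2 = n / 'chi_i 1%g * weight f i.
Proof.
transitivity (\sum_(u in K) \sum_(v in K) (f u)%:R * (f v)%:R
    * \sum_(x in K) 'chi_i (x * u)%g * ('chi_i (x * v)%g)^*).
  rewrite (eq_bigr (fun x => \sum_(u in K) \sum_(v in K) (f u)%:R * (f v)%:R
    * ('chi_i (x * u)%g * ('chi_i (x * v)%g)^*))); last first.
    move=> x _; rewrite normCK /fourier mulr_suml; apply: eq_bigr => u uK.
    rewrite rmorph_sum mulr_sumr; apply: eq_bigr => v vK.
    by rewrite rmorphM /= conjC_nat; ring.
  rewrite exchange_big; apply: eq_bigr => u uK.
  rewrite exchange_big; apply: eq_bigr => v vK.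
  by rewrite mulr_sumr.
rewrite /weight mulr_sumr; apply: eq_bigr => u uK.
rewrite mulr_sumr; apply: eq_bigr => v vK.
have := generalized_orthogonality_relation (v^-1 * u)%g i i.
rewrite eqxx mul1r => /(canRL (mulVKf (neq0CG K))) e.
rewrite [X in _ * X](_ : _ = n * ('chi_i (v^-1 * u)%g / 'chi_i 1%g)); first by ring.
rewrite -e (reindex_inj (mulIg v^-1%g)) /=; apply: eq_big => x.
  by rewrite groupMr ?groupV.
by move=> _; rewrite mulgKV -irr_inv mulgA.
Qed.

Lemma weight_ge0 f i : 0 <= weight f i.
Proof.
have : 0 <= n / 'chi_i 1%g * weight f i.
  by rewrite -sum_fourier_shift sumr_ge0 // => x _; rewrite exprn_ge0.
by rewrite pmulr_rge0 // divr_gt0 ?irr1_gt0 ?gt0CG.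
Qed.

(** Plancherel: weighted by their degrees, the characters add up to the regular character, which
    vanishes off 1. *)
Lemma sum_weight f : \sum_i 'chi_i 1%g * weight f i = n * (sqsum f)%:R.
Proof.
rewrite /weight; transitivity (\sum_(u in K) \sum_(v in K) (f u)%:R * (f v)%:R
    * cfReg K (v^-1 * u)%g).
  rewrite (eq_bigr (fun i => \sum_(u in K) \sum_(v in K) 
     (f u)%:R * (f v)%:R * ('chi_i 1%g * 'chi_i (v^-1 * u)%g))).
    rewrite exchange_big; apply: eq_bigr => u uK.
    rewrite exchange_big; apply: eq_bigr => v vK.
    rewrite -mulr_sumr cfReg_sum sum_cfunE; congr (_ * _).
    by apply: eq_bigr => i _; rewrite cfunE.
  move=> i _; rewrite mulr_sumr; apply: eq_bigr => u _.
  by rewrite mulr_sumr; apply: eq_bigr => v _; ring.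
rewrite /sqsum natr_sum mulr_sumr; apply: eq_bigr => u uK.
rewrite (bigD1 u) //= big1 ?addr0 => [|v /andP[_ vu]]; last first.
  by rewrite cfRegE -eq_mulVg1 (negPf vu) mulr0.
by rewrite cfRegE mulVg eqxx mulr1n natrX; ring.
Qed.

Lemma weight0 f : weight f 0 = (mass f)%:R ^+ 2.
Proof.
rewrite /weight /mass natr_sum expr2 mulr_suml; apply: eq_bigr => u uK.
rewrite mulr_sumr; apply: eq_bigr => v vK.
by rewrite irr0 cfun1E groupM ?groupV // mulr1.
Qed.

Lemma l2gapE f : l2gap f = \sum_(i | i != 0) 'chi_i 1%g * weight f i.
Proof.
apply/eqP; rewrite /l2gap -sum_weight (bigD1 0) //= irr0 cfun11 mul1r weight0.
by rewrite addrAC subrr add0r.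
Qed.

Lemma mass_pushes x f : x \in K -> mass (pushes x f) = (2 * mass f)%N.
Proof.
move=> xK; rewrite /mass big_split /= mul2n -addnn; congr (_ + _)%N.
  rewrite (reindex_inj (mulgI x)) /=; apply: eq_big => g; first by rewrite groupMl.
  by rewrite mulKg.
rewrite (reindex_inj (mulIg x)) /=; apply: eq_big => g; first by rewrite groupMr.
by rewrite mulgK.
Qed.

(** Both placements of [x] contribute equally because an irreducible character is a class
    function. *)
Lemma fourier_pushes x f i : x \in K ->
  fourier (pushes x f) i 1 = 2 * fourier f i x.
Proof.
move=> xK; rewrite /fourier mulr_natl mulr2n.
under eq_bigr do rewrite natrD mulrDl mul1g.
rewrite big_split /=; congr (_ + _).
  rewrite (reindex_inj (mulgI x)) /=; apply: eq_big => g; first by rewrite groupMl.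
  by rewrite mulKg.
rewrite (reindex_inj (mulIg x)) /=; apply: eq_big => g; first by rewrite groupMr.
move=> gxK; rewrite mulgK; congr (_ * _).
by rewrite -(cfunJ 'chi_i (x * g)%g xK) conjgE -!mulgA mulKg.
Qed.

(** In the expanded square each pure term is a translate of [f] and sums to [sqsum f]; the cross
    term correlates [f] with its conjugates, which [sum_fourier] evaluates. *)
Lemma sum_sqsum_pushes f :
  \sum_(x in K) (sqsum (pushes x f))%:R
  = 2 * (n * (sqsum f)%:R + \sum_i `|fourier f i 1| ^+ 2) :> algC.
Proof.
rewrite -sum_fourier mulrDr.
have -> : n * (sqsum f)%:R = \sum_(x in K) (sqsum f)%:R :> algC.
  by rewrite sumr_const mulr_natl.
rewrite !mulr_sumr -big_split; apply: eq_bigr => x xK /=.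
have hl : (\sum_(g in K) f (x^-1 * g)%g ^ 2 = sqsum f)%N.
  rewrite (reindex_inj (mulgI x)) /=; apply: eq_big => g; first by rewrite groupMl.
  by rewrite mulKg.
have hr : (\sum_(g in K) f (g * x^-1)%g ^ 2 = sqsum f)%N.
  rewrite (reindex_inj (mulIg x)) /=; apply: eq_big => g; first by rewrite groupMr.
  by rewrite mulgK.
have hc : (\sum_(u in K) f u * f (x * u * x^-1)%g
           = \sum_(g in K) f (x^-1 * g)%g * f (g * x^-1)%g)%N.
  rewrite [RHS](reindex_inj (mulgI x)) /=; apply: eq_big => g.
    by rewrite groupMl.
  by rewrite mulKg.
rewrite [\sum_(u in K) _](_ : _ = (\sum_(u in K) f u * f (x * u * x^-1)%g)%N%:R).
  rewrite hc -!natrM -natrD; congr (_%:R).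
  rewrite /sqsum /pushes; under eq_bigr do rewrite sqrnD.
  by rewrite !big_split /= hl hr big1_eq addn0 !mul2n -!addnn.
by rewrite natr_sum; apply: eq_bigr => u _; rewrite natrM.
Qed.

Lemma sum_l2gap_pushes f :
  \sum_(x in K) l2gap (pushes x f) = 2 * n * (l2gap f + classgap f).
Proof.
rewrite /l2gap sumrB -mulr_sumr sum_sqsum_pushes.
rewrite [X in _ - X](eq_bigr (fun=> 4 * (mass f)%:R ^+ 2)); last first.
  by move=> x xK; rewrite mass_pushes // natrM; ring.
rewrite sumr_const -mulr_natl (bigD1 0) //= -/(classgap f).
rewrite [fourier f 0 1](_ : _ = (mass f)%:R).
  by rewrite normr_nat; ring.
rewrite /mass natr_sum; apply: eq_bigr => u uK.
by rewrite irr0 mul1g cfun1E uK mulr1.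
Qed.

(** Averaging over [x] yields [weight f i] divided by the degree, whereas [l2gap] carries
    [weight f i] times the degree; the ratio is the inverse squared degree. *)
Lemma sum_classgap_pushes f (D : algC) : 0 < D ->
    (forall i, i != 0 -> D <= 'chi_i 1%g ^+ 2) ->
  \sum_(x in K) classgap (pushes x f) <= 4 * n / D * l2gap f.
Proof.
move=> D0 hD; rewrite /classgap exchange_big /= l2gapE mulr_sumr.
apply: ler_sum => i i0.
rewrite (eq_bigr (fun x => 4 * `|fourier f i x| ^+ 2)); last first.
  by move=> x xK; rewrite fourier_pushes // normrM normr_nat; ring.
rewrite -mulr_sumr sum_fourier_shift !mulrA ler_wpM2r ?weight_ge0 //.
rewrite -!mulrA !ler_wpM2l ?ler0n //.
have c0 := irr1_gt0 i; rewrite mulrC ler_pdivlMr // mulrC ler_pdivrMr //.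
by rewrite -expr2 hD.
Qed.

(* Adding a random letter acts on (l2gap, classgap) by the matrix
   4 #|K| [[1/2, 1/2], [1/D, 0]]; theta is chosen so that energy is contracted
   by a factor lam < 1 once the trivial growth 4 #|K| is taken out. *)
Definition energy (theta : algC) f := l2gap f + theta * classgap f.

Lemma l2gap_le_energy theta f : 0 <= theta -> l2gap f <= energy theta f.
Proof.
move=> t0; rewrite /energy lerDl mulr_ge0 // sumr_ge0 // => i _.
by rewrite exprn_ge0.
Qed.

(** The two inequalities on [lam] say that the row vector (1, theta) times [[1/2, 1/2], [1/D, 0]] is
    at most lam (1, theta) entrywise. *)
Lemma sum_energy_pushes f (D theta lam : algC) :
    0 < D -> (forall i, i != 0 -> D <= 'chi_i 1%g ^+ 2) ->
    0 <= theta -> 1 / 2 + theta / D <= lam -> 1 / 2 <= lam * theta ->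
  \sum_(x in K) energy theta (pushes x f) <= 4 * n * lam * energy theta f.
Proof.
move=> D0 hD t0 h1 h2.
rewrite /energy big_split /= -mulr_sumr sum_l2gap_pushes.
have a0 : 0 <= l2gap f.
  by rewrite l2gapE sumr_ge0 // => i _; rewrite mulr_ge0 ?weight_ge0 ?ltW ?irr1_gt0.
have b0 : 0 <= classgap f by rewrite sumr_ge0 // => i _; rewrite exprn_ge0.
have n0 : 0 <= n by rewrite ler0n.
apply: le_trans (_ : 2 * n * (l2gap f + classgap f)
                     + theta * (4 * n / D * l2gap f) <= _).
  by rewrite lerD2l ler_wpM2l // sum_classgap_pushes.
rewrite (_ : _ + _ = 4 * n * ((1 / 2 + theta / D) * l2gap f + 1 / 2 * classgap f)).
  rewrite -[leRHS]mulrA ler_wpM2l ?mulr_ge0 ?ler0n //.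
  rewrite [leRHS]mulrDr [lam * (theta * _)]mulrA.
  by rewrite lerD // ler_wpM2r.
by field; rewrite gt_eqF.
Qed.

(** Counts, by product, the [2 ^ size s] ways of building a word from the letters of [s], taken from
    last to first, each placed in front or at the back. *)
Fixpoint pushcount (s : seq gT) : gT -> nat :=
  if s is x :: s' then pushes x (pushcount s') else fun g => (g == 1%g).

Lemma mass_pushcount s : {subset s <= K} -> mass (pushcount s) = (2 ^ size s)%N.
Proof.
elim: s => [|x s IH] sK /=.
  rewrite /mass (bigD1 1%g) //= eqxx big1 // => g /andP[_ g1].
  by rewrite (negPf g1).
rewrite mass_pushes ?IH ?expnS //; last by apply: sK; rewrite mem_head.
by move=> y ys; apply: sK; rewrite inE ys orbT.
Qed.

Lemma energy_nil theta : energy theta (pushcount [::]) = (n - 1) * (1 + theta).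
Proof.
have e1 (F : gT -> algC) : \sum_(u in K) (u == 1%g)%:R * F u = F 1%g.
  rewrite (bigD1 1%g) //= eqxx mul1r big1 ?addr0 // => g /andP[_ g1].
  by rewrite (negPf g1) mul0r.
have t1 : mass (pushcount [::]) = 1%N by rewrite mass_pushcount.
have s1 : sqsum (pushcount [::]) = 1%N.
  by rewrite -t1; apply: eq_bigr => g _ /=; case: eqP.
rewrite /energy /l2gap s1 t1 expr1n mulr1.
rewrite [classgap _](_ : _ = n - 1); first by ring.
rewrite -irr_sum_square (bigD1 0) //= irr0 cfun11 expr1n addrAC subrr add0r.
apply: eq_bigr => i _; rewrite /fourier /=.
rewrite (e1 (fun u => 'chi_i (1 * u)%g)) mul1g ger0_norm //.
by rewrite ltW ?irr1_gt0.
Qed.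

Lemma sum_energy_tuples (D theta lam : algC) t :
    0 < D -> (forall i, i != 0 -> D <= 'chi_i 1%g ^+ 2) ->
    0 <= theta -> 1 / 2 + theta / D <= lam -> 1 / 2 <= lam * theta ->
  \sum_(s : t.-tuple gT | all (mem K) s) energy theta (pushcount s)
    <= (4 * n * lam) ^+ t * ((n - 1) * (1 + theta)).
Proof.
move=> D0 hD t0 h1 h2; elim: t => [|t IH].
  rewrite expr0 mul1r (big_pred1 [tuple]) ?energy_nil // => s.
  by rewrite [s]tuple0 /= eqxx.
have l0 : 0 <= 4 * n * lam.
  by rewrite mulr_ge0 ?mulr_ge0 ?ler0n // (le_trans _ h1) // addr_ge0 ?divr_ge0 ?ler0n // ltW.
rewrite (partition_big (@thead _ _) (mem K)) /=; last first.
  by move=> s; case/tupleP: s => x s /= /andP[].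
rewrite (eq_bigr (fun x => \sum_(s : t.-tuple gT | all (mem K) s)
     energy theta (pushes x (pushcount s)))); last first.
  move=> x xK; rewrite (reindex (fun s : t.-tuple gT => [tuple of x :: s])) /=.
    by apply: eq_bigl => s; rewrite theadE eqxx andbT /= xK.
  exists (fun s : t.+1.-tuple gT => [tuple of behead s]) => s /=.
    by move=> _; apply: val_inj.
  case/tupleP: s => y s; rewrite inE /= theadE => /andP[_ /eqP->].
  exact: val_inj.
rewrite exchange_big exprS -mulrA /=.
apply: le_trans (_ : \sum_(s : t.-tuple gT | all (mem K) s)
   4 * n * lam * energy theta (pushcount s) <= _).
  by apply: ler_sum => s _; apply: (sum_energy_pushes _ D0 hD).
by rewrite -mulr_sumr ler_wpM2l.
Qed.

End Energy.

(** * From few collisions to many products *)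

Section PerfectCover.
Local Open Scope group_scope.
Variables (gT : finGroupType) (K : {group gT}).
Implicit Types (f : gT -> nat) (s : seq gT).

Lemma pushcount_ordprods s g : (0 < pushcount s g)%N -> g \in ordprods s.
Proof.
elim: s g => [|x s IH] g /=.
  rewrite lt0b => /eqP->; apply/ordprodsP; exists [::] => //.
  by rewrite big_nil.
rewrite addn_gt0 => /orP[/IH|/IH]/ordprodsP[t p e]; apply/ordprodsP.
  by exists (x :: t); rewrite ?perm_cons // big_cons -e mulKVg.
by exists (rcons t x); rewrite ?perm_rcons ?perm_cons // -cats1 big_cat big_seq1 /= -e mulgKV.
Qed.

(** Cauchy-Schwarz on the support of [f]. *)
Lemma mass_sq_le f :
  (mass K f ^ 2 <= #|[set g in K | 0 < f g]| * sqsum K f)%N.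
Proof.
set A := [set g in K | _].
have AK (F : gT -> nat) : (forall g, f g = 0 -> F g = 0)%N ->
    (\sum_(g in K) F g = \sum_(g in A) F g)%N.
  move=> F0; rewrite (bigID (fun g => (0 < f g)%N)) /= addnC big1 => [|g].
    by apply: eq_bigl => g; rewrite inE.
  by rewrite -eqn0Ngt => /andP[_ /eqP/F0].
have -> : mass K f = (\sum_(g in A) f g)%N by rewrite /mass AK.
have -> : sqsum K f = (\sum_(g in A) f g ^ 2)%N.
  by rewrite /sqsum AK // => g ->.
rewrite -(leq_pmul2l (isT : (0 < 2)%N)).
apply: (@leq_trans (\sum_(g in A) \sum_(h in A) (f g ^ 2 + f h ^ 2))%N).
  rewrite expnS expn1 big_distrlr /= big_distrr leq_sum //= => g _.
  by rewrite big_distrr leq_sum //= => h _; exact: nat_Cauchy.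
under eq_bigr do rewrite big_split sum_nat_const /=.
by rewrite big_split /= sum_nat_const -big_distrr /= mul2n addnn.
Qed.

(** Pigeonhole: for [g] in [K], the sets [A] and [g B^-1] are too large to be disjoint inside
    [K]. *)
Lemma mulg_cover (A B : {set gT}) :
  A \subset K -> B \subset K -> (#|K| < #|A| + #|B|)%N -> K \subset A * B.
Proof.
move=> sAK sBK ltK; apply/subsetP=> g gK.
pose C : {set gT} := [set g * b^-1 | b in B].
have sC : C \subset K.
  apply/subsetP=> _ /imsetP[b bB ->].
  by rewrite groupM ?groupV // (subsetP sBK).
have cC : #|C| = #|B| by rewrite card_imset // => b c /mulgI/invg_inj.
have : A :&: C != set0.
  have := cardsUI A C; rewrite -card_gt0 cC.
  have : (#|A :|: C| <= #|K|)%N by rewrite subset_leq_card // subUset sAK.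
  lia.
case/set0Pn=> a /setIP[aA /imsetP[b bB e]].
by apply/mulsgP; exists a b => //; rewrite e mulgKV.
Qed.

(** By Cauchy-Schwarz, #|K| (1/#|A| + 1/#|B|) < 4 for the sets [A], [B] of products reached; the sum
    of inverses is at least 4/(#|A| + #|B|), so [mulg_cover] applies. *)
Lemma disjoint_pair_covers (t : nat) (Y Z : t.-tuple gT) :
    {subset Y <= K} -> {subset Z <= K} ->
    (#|K| * sqsum K (pushcount Y) + #|K| * sqsum K (pushcount Z) < 4 * 4 ^ t)%N ->
  K \subset ordprods (Y ++ Z).
Proof.
move=> YK ZK; set M := (4 ^ t)%N.
have tot (X : t.-tuple gT) : {subset X <= K} -> (mass K (pushcount X) ^ 2 = M)%N.
  by move=> XK; rewrite mass_pushcount // size_tuple -expnM mulnC expnM.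
have := mass_sq_le (pushcount Y); have := mass_sq_le (pushcount Z).
rewrite !tot //; set A := [set g in K | _]; set B := [set g in K | _].
set a := sqsum _ _; set b := sqsum _ _ => hA hB hM.
have sA : B \subset K by apply/subsetP=> g; rewrite inE => /andP[].
have sB : A \subset K by apply/subsetP=> g; rewrite inE => /andP[].
have M0 : (0 < M)%N by rewrite expn_gt0.
have A0 : (0 < #|A|)%N by case: #|A| hA => //; rewrite mul0n; lia.
have B0 : (0 < #|B|)%N by case: #|B| hB => //; rewrite mul0n; lia.
have lt : (#|K| < #|B| + #|A|)%N.
  rewrite ltnNge; apply/negP => le.
  have K0 := cardG_gt0 K; clear tot; clearbody M a b.
  move: #|K| #|A| #|B| a b M hA hB hM M0 A0 B0 le K0 => n x y a' b' m hA hB hM m0 x0 y0 le n0.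
  have h1 : (4 * (x * y) <= n * (x + y))%N.
    by apply: leq_trans (nat_AGM2 x y) _; rewrite leq_mul2r addnC le orbT.
  have h2 : (n * m * (x + y) <= (n * b' + n * a') * (x * y))%N.
    have e1 : (n * y * m <= n * y * (x * a'))%N by rewrite leq_mul2l hA orbT.
    have e2 : (n * x * m <= n * x * (y * b'))%N by rewrite leq_mul2l hB orbT.
    nia.
  have h3 : ((n * b' + n * a') * (x * y) < 4 * m * (x * y))%N.
    by rewrite ltn_mul2r muln_gt0 x0 y0.
  have h4 : (m * (4 * (x * y)) <= m * (n * (x + y)))%N by rewrite leq_mul2l h1 orbT.
  lia.
apply: subset_trans (mulg_cover sA sB lt) _.
apply/subsetP=> x /mulsgP[g h]; rewrite [g \in _]inE [h \in _]inE => /andP[_ g0] /andP[_ h0] ->.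
by apply: ordprods_cat; apply: pushcount_ordprods.
Qed.

End PerfectCover.

(** * Averaging over pairs of disjoint tuples *)

Section Averaging.
Local Open Scope ring_scope.
Variables (gT : finGroupType) (K : {group gT}).

(** First moment method: the average of [gap Y + gap Z] over disjoint pairs is below [2 * 4 ^ t]. As
    both masses are [2 ^ t], any pair below this value satisfies the collision bound. *)
Lemma exists_disjoint_pair (t : nat) (D theta lam : algC) :
    0 < D -> (forall i : Iirr K, i != 0 -> D <= 'chi_i 1%g ^+ 2) ->
    0 <= theta -> 1 / 2 + theta / D <= lam -> 1 / 2 <= lam * theta ->
    (t.*2 <= #|K|)%N ->
    (#|K|%:R * lam) ^+ t * ((#|K|%:R - 1) * (1 + theta)) < (#|K| ^_ t)%:R ->
  exists Y : t.-tuple gT, exists2 Z : t.-tuple gT,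
    [/\ uniq (Y ++ Z), {subset Y <= K} & {subset Z <= K}] &
    (#|K| * sqsum K (pushcount Y) + #|K| * sqsum K (pushcount Z) < 4 * 4 ^ t)%N.
Proof.
move=> D0 hD t0 h1 h2 tK lt.
(* Each of Y and Z is uniform among the repetition-free tuples, whose average gap
   is at most the sum over all tuples divided by #|K| ^_ t. *)
pose disj (Y Z : t.-tuple gT) := all [pred x | (x \in K) && (x \notin Y)] Z && uniq Z.
pose U (Y : t.-tuple gT) := all (mem K) Y && uniq Y.
pose gap (Y : t.-tuple gT) := l2gap K (pushcount Y).
have gap0 Y : 0 <= gap Y.
  by rewrite /gap l2gapE sumr_ge0 // => i _; rewrite mulr_ge0 ?weight_ge0 ?ltW ?irr1_gt0.
have disjU Y Z : disj Y Z -> U Z.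
  by case/andP=> /allP dYZ uZ; rewrite /U uZ andbT; apply/allP=> x /dYZ/andP[].
have disjC Y Z : U Y && disj Y Z = U Z && disj Z Y.
  rewrite /U /disj !all_predI; set a := all _ Y; set b := all _ Z.
  rewrite (_ : all [pred x | x \notin Y] Z = all [pred x | x \notin Z] Y).
    by case: a; case: b; case: (uniq Y); case: (uniq Z) => //=; rewrite ?andbF.
  have e (A B : seq gT) : all [pred x | x \notin A] B = ~~ has (mem A) B.
    by rewrite -all_predC; apply: eq_all.
  by rewrite !e has_sym.
have [/existsP[Y /existsP[Z /and3P[UY dYZ ltYZ]]]|no] :=
    boolP [exists Y, exists Z, [&& U Y, disj Y Z & gap Y + gap Z < 2 * 4 ^+ t]].
  have UZ := disjU _ _ dYZ; exists Y, Z.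
    case/andP: UY => /allP YK uY; case/andP: UZ => /allP ZK uZ.
    split=> //; rewrite cat_uniq uY uZ andbT /= -all_predC.
    by case/andP: dYZ => /allP dYZ _; apply/allP=> x /dYZ/andP[].
  have tot (X : t.-tuple gT) : U X -> (mass K (pushcount X))%:R ^+ 2 = 4 ^+ t :> algC.
    case/andP=> /allP XK _; rewrite mass_pushcount // size_tuple.
    by rewrite natrX -exprM mulnC exprM -natrX.
  move: ltYZ; rewrite /gap /l2gap !tot // -(ltr_nat algC) natrD !natrM natrX.
  by rewrite addrACA -opprD ltrBlDr => /lt_le_trans; apply; rewrite le_eqVlt;
     apply/orP; left; apply/eqP; ring.
have gapge Y Z : U Y -> disj Y Z -> 2 * 4 ^+ t <= gap Y + gap Z.
  move=> UY dYZ; move: no; rewrite negb_exists => /forallP/(_ Y).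
  rewrite negb_exists => /forallP/(_ Z); rewrite UY dYZ /=.
  have := addr_ge0 (gap0 Y) (gap0 Z); move: (gap Y + gap Z) => S S0.
  by rewrite -real_leNgt ?ger0_real ?mulr_ge0 ?exprn_ge0 ?ler0n.
pose m := ((#|K| - t) ^_ t)%N.
have cardD Y : U Y -> #|[pred Z | disj Y Z]| = m.
  case/andP=> YK uY.
  have := card_uniq_tuples t [pred x | (x \in K) && (x \notin Y)].
  rewrite cardsE => ->; congr (_ ^_ _)%N.
  have eY : #|[pred x in K | x \in Y]| = t.
    rewrite -[RHS](size_tuple Y) -(card_uniqP uY); apply: eq_card => x; rewrite !inE.
    by case: (boolP (x \in Y)) => [xY|]; rewrite ?andbF // andbT; exact: (allP YK).
  rewrite -[in RHS](cardID (mem Y) K) [X in (_ = X + _ - _)%N](_ : _ = t).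
    by rewrite addKn; apply: eq_card => x; rewrite !inE andbC.
  by rewrite -[RHS]eY; apply: eq_card => x; rewrite !inE andbC.
have cardU : #|[pred Y | U Y]| = (#|K| ^_ t)%N.
  by have := card_uniq_tuples t (mem K); rewrite cardsE.
have m0 : (0 < m)%N by rewrite ffact_gt0; lia.
have le1 : \sum_(Y | U Y) gap Y <= (4 * #|K|%:R * lam) ^+ t * ((#|K|%:R - 1) * (1 + theta)).
  apply: le_trans (sum_energy_tuples t D0 hD t0 h1 h2).
  apply: le_trans (_ : \sum_(s : t.-tuple gT | all (mem K) s) gap s <= _).
    rewrite [leRHS](bigID (fun s : t.-tuple gT => uniq s)) /= lerDl.
    by rewrite sumr_ge0.
  by apply: ler_sum => s _; apply: l2gap_le_energy.
(* Every admissible tuple has the same number [m] of disjoint partners, and the relation is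
   symmetric, so the pair sums of [gap Y] and of [gap Z] agree. *)
have sum1 : \sum_(Y | U Y) \sum_(Z | disj Y Z) gap Y = m%:R * \sum_(Y | U Y) gap Y.
  rewrite mulr_sumr; apply: eq_bigr => Y UY.
  by rewrite sumr_const -(cardD Y UY) mulr_natl.
have sum2 : \sum_(Y | U Y) \sum_(Z | disj Y Z) gap Z = m%:R * \sum_(Y | U Y) gap Y.
  rewrite -sum1 (exchange_big_dep U) => [|Y Z _ /disjU//] /=.
  apply: eq_bigr => Z UZ; apply: eq_bigl => Y.
  by rewrite disjC UZ.
have : \sum_(Y | U Y) \sum_(Z | disj Y Z) (2 * 4 ^+ t : algC)
     <= 2 * m%:R * \sum_(Y | U Y) gap Y.
  rewrite -mulrA [leRHS]mulr_natl mulr2n.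
  rewrite -[X in _ <= X + _]sum1 -[X in _ <= _ + X]sum2 -big_split /=.
  apply: ler_sum => Y UY; rewrite -big_split; apply: ler_sum => Z dYZ.
  exact: gapge.
rewrite (eq_bigr (fun=> m%:R * (2 * 4 ^+ t))) => [|Y UY]; last first.
  by rewrite sumr_const -(cardD Y UY) [RHS]mulr_natl.
rewrite sumr_const [#|_|](_ : _ = #|[pred Y | U Y]|) // cardU -[leLHS]mulr_natl => le2.
suff : (4 * #|K|%:R * lam) ^+ t * ((#|K|%:R - 1) * (1 + theta)) < 4 ^+ t * (#|K| ^_ t)%:R :> algC.
  move=> lt2; have := le_lt_trans le1 lt2; rewrite -(ltr_pM2l (x := 2 * m%:R)).
    move/(le_lt_trans le2); rewrite (_ : _ * _ = 2 * m%:R * (4 ^+ t * (#|K| ^_ t)%:R)) ?ltxx //.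
    by ring.
  by rewrite mulr_gt0 ?ltr0n.
by rewrite -mulrA exprMn -mulrA ltr_pM2l // exprn_gt0 ?ltr0n.
Qed.

End Averaging.

(** * Numerical estimates *)

Section Numeric.
Local Open Scope nat_scope.

(** With denominators cleared: (2N - 2i) / (2N - 2i - 1) is at most (2N - 2i) / (2N - 2i - 2), and
    the latter telescope to 2N / (2N - 2t). *)
Lemma ffact_double N t : t <= N ->
  4 ^ t * (N ^_ t) ^ 2 * (2 * N - 2 * t) <= 2 * N * (2 * N) ^_ (2 * t).
Proof.
elim: t => [|t IH] lt; first by rewrite !muln0 !ffactn0 subn0 exp1n !muln1 mul1n.
have := IH (ltnW lt); rewrite mulnS !add2n !ffactnSr expnS.
set a := N ^_ t; set b := (2 * N) ^_ (2 * t); set c := 4 ^ t => h.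
apply: (@leq_trans (c * a ^ 2 * (2 * N - 2 * t) * ((2 * N - 2 * t) * (2 * N - (2 * t).+1)))).
  have -> : 2 * N - 2 * t = 2 * (N - t) by rewrite mulnBr.
  rewrite !expnS !expn0 !muln1.
  have le : 2 * N - (2 * t).+2 <= 2 * N - (2 * t).+1 by lia.
  have := leq_mul2l (4 * c * a * a * (N - t) * (N - t)) (2 * N - (2 * t).+2) (2 * N - (2 * t).+1).
  by rewrite le orbT; lia.
by rewrite [2 * N * _](_ : _ = 2 * N * b * ((2 * N - 2 * t) * (2 * N - (2 * t).+1)));
  [rewrite leq_mul2r h orbT | rewrite !mulnA].
Qed.

(** Factor by factor, 1 - i/N <= 1 - i/n. *)
Lemma ffact_ratio N n t : N <= n -> N ^_ t * n ^ t <= n ^_ t * N ^ t.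
Proof.
move=> le; elim: t => [|t IH]; first by rewrite !ffactn0.
rewrite !ffactnSr !expnSr mulnACA [leqRHS]mulnACA leq_mul //.
by rewrite !mulnBl [n * N]mulnC leq_sub2l // leq_mul2l le orbT.
Qed.

(* With lam = p / q and 1 + theta <= 2, this makes t letters enough for every group
   order in [N, 2N); the property passes from (N, t) to (2N, 2t), so that one
   instance serves all larger orders. *)
Definition collision_bound (p q N t : nat) :=
  (2 * t <= N) && (4 * N * (p * N) ^ t <= q ^ t * N ^_ t).

(** Squaring the instance at [N] leaves a spare factor [N], and [2 * t <= N] keeps the loss 2N / (2N
    - 2t) of [ffact_double] at most 2. *)
Lemma collision_bound_double p q N t : 0 < N ->
  collision_bound p q N t -> collision_bound p q (2 * N) (2 * t).
Proof.
move=> N0 /andP[tN h]; rewrite /collision_bound leq_mul2l tN /=.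
have h2 : 4 ^ t * (N ^_ t) ^ 2 <= 2 * (2 * N) ^_ (2 * t).
  rewrite -(leq_pmul2r N0) -mulnA [2 * _ * N]mulnAC.
  have le : t <= N by lia.
  apply: leq_trans (ffact_double le); rewrite -mulnA !leq_mul2l.
  by apply/orP; right; apply/orP; right; lia.
have h3 : (4 * N * (p * N) ^ t) ^ 2 <= (q ^ t * N ^_ t) ^ 2 by rewrite leq_sqr.
rewrite -(leq_pmul2l (isT : 0 < 2)) [2 * (q ^ _ * _)]mulnCA.
apply: leq_trans (leq_mul (leqnn _) h2).
have -> : q ^ (2 * t) * (4 ^ t * (N ^_ t) ^ 2) = 4 ^ t * (q ^ t * N ^_ t) ^ 2.
  by rewrite expnMn -expnM [t * 2]mulnC mulnCA.
apply: leq_trans (leq_mul (leqnn _) h3).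
rewrite !expnMn -!expnM [in t * 2]mulnC.
have -> : 2 ^ (2 * t) = 4 ^ t by rewrite expnM.
move: (4 ^ t) (p ^ _) (N ^ (2 * t)) => a b c.
rewrite [leqLHS](_ : _ = 16 * N * (a * b * c)); last by lia.
rewrite [leqRHS](_ : _ = 16 * N * (a * b * c) * N); last by lia.
by rewrite leq_pmulr.
Qed.

Lemma collision_bound_ge p q N0 t0 n : 0 < N0 -> 0 < p -> collision_bound p q N0 t0 ->
  N0 <= n -> exists2 t, 2 * t <= n & 2 * n * (p * n) ^ t < q ^ t * n ^_ t.
Proof.
move=> N00 p0 b0 le.
have [N [t [cN Nn]]] : exists N t, collision_bound p q N t /\ N <= n < 2 * N.
  elim: n le => [|n IH] le; first by move: N00 le; case: N0 b0.
  rewrite leq_eqVlt in le; case/orP: le => [/eqP<-|/IH[N [t [cN /andP[Nn nN]]]]].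
    by exists N0, t0; split=> //; lia.
  have [ltN|geN] := ltnP n.+1 (2 * N); first by exists N, t; split=> //; lia.
  exists (2 * N), (2 * t); split; last by lia.
  by apply: collision_bound_double cN; lia.
have {Nn}[Nn nN] := andP Nn; have {cN}[tN h] := andP cN.
exists t; first by lia.
have Npos : 0 < N by lia.
have r := ffact_ratio t Nn.
have Nt : 0 < N ^ t by rewrite expn_gt0 Npos.
rewrite -(ltn_pmul2r Nt) -[X in _ < X]mulnA.
apply: leq_trans (leq_mul (leqnn (q ^ t)) r); rewrite mulnA.
apply: leq_trans (leq_mul h (leqnn (n ^ t))).
rewrite !expnMn.
have pos : 0 < p ^ t * N ^ t * n ^ t.
  by rewrite !muln_gt0 !expn_gt0 p0 Npos (leq_trans Npos Nn).
rewrite [X in X < _](_ : _ = 2 * n * (p ^ t * N ^ t * n ^ t)); last by lia.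
rewrite [X in _ < X](_ : _ = 4 * N * (p ^ t * N ^ t * n ^ t)); last by lia.
by rewrite ltn_pmul2r //; lia.
Qed.

(* Here and below, t minimises the quotient of the two sides. *)
Lemma collision_bound60 : collision_bound 3 5 60 24.
Proof.
rewrite /collision_bound /= !ffactnS ffactn0 /=.
lia.
Qed.

Lemma collision_bound120 : collision_bound 11 16 120 38.
Proof.
rewrite /collision_bound /= !ffactnS ffactn0 /=.
lia.
Qed.

End Numeric.

(** * Orders below 60 excluded by sums of squares of divisors *)

Section SquareSums.
Local Open Scope nat_scope.

(* Is m a sum of at most k squares of divisors d of n with 3 <= d <= 7?  Larger d
   cannot occur below 60. *)
Fixpoint square_sum (k n m : nat) : bool :=
  (m == 0) || (if k is k'.+1 then
    has (fun d => if (d %| n) && (d ^ 2 <= m) then square_sum k' n (m - d ^ 2)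
                  else false) (iota 3 5)
  else false).

Lemma square_sumP n (ds : seq nat) k m :
    all (fun d => (2 < d) && (d %| n)) ds -> \sum_(d <- ds) d ^ 2 = m ->
    m < 60 -> size ds <= k -> square_sum k n m.
Proof.
elim: ds k m => [|d ds IH] k m /=.
  by rewrite big_nil => _ <- _ _; case: k.
case/andP=> /andP[d2 dn] ads; rewrite big_cons => em m60.
case: k => // k sk.
suff : has (fun d => if (d %| n) && (d ^ 2 <= m) then square_sum k n (m - d ^ 2)
                     else false) (iota 3 5).
  by move=> h; apply/orP; right.
apply/hasP; exists d.
  by rewrite mem_iota; nia.
by rewrite dn -em leq_addr addKn /= IH //; lia.
Qed.

Lemma square_sum_size (ds : seq nat) :
  all (fun d => 2 < d) ds -> 9 * size ds <= \sum_(d <- ds) d ^ 2.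
Proof.
elim: ds => [|d ds IH] /=; first by rewrite big_nil.
by case/andP=> d2 /IH; rewrite big_cons; nia.
Qed.

Lemma square_sum_lt60 n (ds : seq nat) :
    all (fun d => (2 < d) && (d %| n)) ds -> \sum_(d <- ds) d ^ 2 = n.-1 ->
  1 < n -> 60 <= n.
Proof.
move=> ads e n1; rewrite leqNgt; apply/negP => n60.
have s9 : 9 * size ds <= n.-1.
  by rewrite -e square_sum_size //; apply: sub_all ads => d /andP[].
(* Each square is at least 9 and the sum at most 58, so 7 summands suffice; the orders 2 to 59 are
   checked by computation. *)
have := square_sumP ads e; move=> /(_ 7); move/(_ ltac:(lia) ltac:(lia)).
have : all (fun n => ~~ square_sum 7 n n.-1) (iota 2 58) by vm_compute.
by move/allP/(_ n); rewrite mem_iota => /(_ ltac:(lia))/negPf->.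
Qed.

End SquareSums.

(** * Perfect groups *)

Section PerfectDegrees.
Local Open Scope group_scope.
Local Open Scope ring_scope.

Lemma irr1_nat (gT : finGroupType) (K : {group gT}) (i : Iirr K) :
  exists2 d : nat, 'chi_i 1%g = d%:R & (d %| #|K|)%N.
Proof.
have /natrP[d e] := Cnat_irr1 i; exists d => //.
by have := dvd_irr1_cardG i; rewrite e dvdC_nat.
Qed.

Lemma perfect_linear (gT : finGroupType) (K : {group gT}) (xi : 'CF(K)) :
  K^`(1)%g = K -> xi \is a linear_char -> xi = 1.
Proof.
move=> pK lxi; have := lin_char_der1 lxi; rewrite pK => sK.
apply/cfun_inP=> x xK; rewrite cfun1E xK.
by have := subsetP sK x xK; rewrite cfkerEchar ?lin_charW // inE => /andP[_ /eqP->];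
   rewrite lin_char1.
Qed.

Lemma perfect_irr_degree (gT : finGroupType) (K : {group gT}) (i : Iirr K) (d : nat) :
  K^`(1)%g = K -> i != 0 -> 'chi_i 1%g = d%:R -> (1 < d)%N.
Proof.
move=> pK i0 e; rewrite ltn_neqAle eq_sym -(ltr_nat algC) -e irr1_gt0 andbT.
apply: contraNneq i0 => d1; rewrite -irr_eq1; apply/eqP; apply: perfect_linear => //.
by rewrite qualifE /= irr_char e d1 eqxx.
Qed.

(** The nontrivial degrees are divisors of #|K|, at least 3, whose squares sum to #|K| - 1. *)
Lemma perfect_degree_ge3 (gT : finGroupType) (K : {group gT}) :
    K^`(1)%g = K -> K :!=: 1%g -> (forall i : Iirr K, 'chi_i 1%g != 2) ->
  (60 <= #|K|)%N.
Proof.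
move=> pK K1 n2; rewrite -cardG_gt1 in K1.
have [deg degE degD] : exists2 deg : Iirr K -> nat,
    forall i, 'chi_i 1%g = (deg i)%:R & forall i, (deg i %| #|K|)%N.
  exists (fun i => Num.truncn ('chi_i 1%g)) => i.
    by have [d -> _] := irr1_nat i; rewrite natrK.
  by have [d -> dd] := irr1_nat i; rewrite natrK.
apply: (@square_sum_lt60 _ [seq deg i | i <- enum [pred i : Iirr K | i != 0]]) => //.
  apply/allP=> _ /mapP[i i0 ->]; rewrite degD andbT.
  have i0' : i != 0 by move: i0; rewrite mem_enum.
  rewrite ltn_neqAle (perfect_irr_degree pK i0' (degE i)) andbT.
  by apply: contra (n2 i) => /eqP e; rewrite degE -e.
rewrite big_map big_enum /=; apply/eqP; rewrite -(eqr_nat algC).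
rewrite -subn1 natrB ?cardG_gt0 // -irr_sum_square.
rewrite [X in _ == X - _](bigD1 0) //= irr0 cfun11 expr1n.
rewrite addrAC subrr add0r natr_sum; apply/eqP/eq_bigr => i _.
by rewrite degE natrX.
Qed.

(* The determinant of a representation of a perfect group is 1, so an involution
   acts in degree 2 with eigenvalues both 1 or both -1, that is, as a scalar. *)
Lemma faithful_degree2_center (gT : finGroupType) (K : {group gT}) (i : Iirr K) :
    K^`(1)%g = K -> 'chi_i 1%g = 2 -> cfaithful 'chi_i ->
  exists2 x, x \in 'Z(K)%g & #[x]%g = 2%N.
Proof.
move=> pK d2 fi.
have := dvd_irr1_cardG i; rewrite d2 (dvdC_nat 2) => /(Cauchy (isT : prime 2))[x xK ox].
exists x => //.
have /char_reprP[[m rG] /= e] := irr_char i.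
have m2 : m = 2%N.
  by apply/eqP; rewrite -(eqr_nat algC) -d2 e cfRepr1.
subst m.
have inj : {in K &, injective rG}.
  by apply: mx_faithful_inj; rewrite /mx_faithful -cfker_repr -e.
have detx : \det (rG x) = 1.
  have lin : detRepr rG = 1 by apply: perfect_linear => //; exact: detRepr_lin_char.
  have := congr1 (fun f : 'CF(K) => f x) lin; rewrite cfunE xK cfun1E xK.
  by rewrite mxtrace_scalar !mulr1n.
have [ev [[B uB eB] [evx _] _ _]] := repr_rsim_diag rG xK.
rewrite ox in evx.
have ev12 : ev 0 0 = ev 0 1.
  have : ev 0 0 * ev 0 1 = 1.
    rewrite -detx eB !det_mulmx det_inv mulrAC mulVf; last by rewrite -unitfE -unitmxE.
    by rewrite mul1r det_diag big_ord_recl big_ord1; congr (_ * ev _ _); apply: val_inj.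
  by move=> h; rewrite -[LHS]mulr1 -(evx 1) expr2 mulrA h mul1r.
have sc : rG x = (ev 0 0)%:M.
  rewrite eB (_ : diag_mx ev = (ev 0 0)%:M).
    by rewrite mul_mx_scalar -scalemxAl mulVmx // scalemx1.
  apply/matrixP=> a b; rewrite !mxE; congr (_ *+ _).
  case: a => -[|[|//]] la; first by congr (ev _ _); apply: val_inj.
  by rewrite ev12; congr (ev _ _); apply: val_inj.
apply/centerP; split=> // y yK; apply: inj; rewrite ?groupM //.
by rewrite !repr_mxM // sc scalar_mxC.
Qed.

(** A character of degree 2 becomes faithful on the quotient [L] by its kernel, so [L] has a central
    involution [x]. Then [L / <[x]>] is perfect, nontrivial and smaller than [K], and induction
    gives #|K| >= 2 * 60. *)
Lemma perfect_order (gT : finGroupType) (K : {group gT}) :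
    K^`(1)%g = K -> K :!=: 1%g ->
  (60 <= #|K|)%N /\ ((exists i : Iirr K, 'chi_i 1%g = 2) -> (120 <= #|K|)%N).
Proof.
have [n] := ubnP #|K|; elim: n => // n IH in gT K *; rewrite ltnS => leKn pK K1.
suff h120 : (exists i : Iirr K, 'chi_i 1%g = 2) -> (120 <= #|K|)%N.
  split=> //; have [/existsP[i /eqP e]|] := boolP [exists i : Iirr K, 'chi_i 1%g == 2].
    by apply: leq_trans (h120 _) => //; exists i.
  rewrite negb_exists => /forallP n2; exact: perfect_degree_ge3.
case=> i d2; pose L := (K / cfker 'chi_i)%G.
have nK : cfker 'chi_i <| K := cfker_normal _.
have pL : L^`(1)%g = L by rewrite /= -quotient_der ?normal_norm // pK.
have dj : 'chi_(quo_Iirr (cfker 'chi_i) i) 1%g = 2.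
  by rewrite quo_IirrE // cfQuo1.
have fj : cfaithful 'chi_(quo_Iirr (cfker 'chi_i) i).
  by rewrite quo_IirrE // cfaithful_quo.
have [x xZ ox] := faithful_degree2_center pL dj fj.
have sxL : <[x]>%g \subset L by rewrite cycle_subG; case/setIP: xZ.
have nxL : <[x]>%g <| L by apply: sub_center_normal; rewrite cycle_subG.
have cL : #|L| = (2 * #|L / <[x]>|%g)%N.
  by rewrite -ox -(Lagrange sxL) card_quotient ?normal_norm.
have pM : ((L / <[x]>)^`(1) = L / <[x]>)%g.
  by rewrite -quotient_der ?normal_norm // pL.
have leL : (#|L| <= #|K|)%N by apply: leq_morphim.
(* Otherwise [L] would be abelian, hence trivial as a perfect group, against its even order. *)
have M1 : (L / <[x]> != 1)%g.
  apply/eqP=> M1; have : abelian L.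
    apply: (@abelianS _ _ <[x]>%G); last exact: cycle_abelian.
    by rewrite -quotient_sub1 ?M1 // normal_norm.
  move/derG1P; rewrite pL => L1.
  by move/(congr1 odd): cL; rewrite L1 cards1 oddM.
have leM : (2 * #|(L / <[x]>)%G| <= #|K|)%N by rewrite -cL.
have M0 : (0 < #|(L / <[x]>)%G|)%N := cardG_gt0 _.
have ltM : (#|(L / <[x]>)%G| < n)%N.
  by apply: leq_trans leKn; apply: leq_trans leM; rewrite ltn_Pmull.
have [h60 _] := IH _ (L / <[x]>)%G ltM pM M1.
by apply: leq_trans leM; rewrite (@leq_pmul2l 2 60).
Qed.

Theorem perfect_covers (gT : finGroupType) (K : {group gT}) :
  K^`(1)%g = K -> K :!=: 1%g -> covers (enum K) K.
Proof.
move=> pK K1; have [o60 o120] := perfect_order pK K1.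
suff [t [Y [Z [uYZ YK ZK] lt]]] : exists t, exists Y : t.-tuple gT, exists2 Z : t.-tuple gT,
    [/\ uniq (Y ++ Z), {subset Y <= K} & {subset Z <= K}] &
    (#|K| * sqsum K (pushcount Y) + #|K| * sqsum K (pushcount Z) < 4 * 4 ^ t)%N.
  have sub := disjoint_pair_covers YK ZK lt.
  (* The leftover letters, kept in one fixed order, contribute a constant factor in [K]. *)
  pose r := [seq x <- enum K | x \notin Y ++ Z].
  have p : perm_eq ((Y ++ Z) ++ r) (enum K).
    by apply: perm_cat_complement => // x; rewrite mem_cat => /orP[/YK|/ZK].
  apply: perm_covers p _; exists (\prod_(x <- r) x)%g.
  have rK : (\prod_(x <- r) x)%g \in K.
    by rewrite big_seq group_prod // => x; rewrite mem_filter mem_enum => /andP[].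
  rewrite lcoset_id //; apply/subsetP=> g gK.
  have -> : g = (g * (\prod_(x <- r) x)^-1 * \prod_(x <- r) x)%g by rewrite mulgKV.
  apply: ordprods_cat (mem_ordprods _).
  by apply: (subsetP sub); rewrite groupM ?groupV.
have exp (p q : nat) (theta : algC) t : (0 < q)%N -> 0 <= theta <= 1 ->
    (2 * #|K| * (p * #|K|) ^ t < q ^ t * #|K| ^_ t)%N ->
  (#|K|%:R * (p%:R / q%:R)) ^+ t * ((#|K|%:R - 1) * (1 + theta)) < (#|K| ^_ t)%:R :> algC.
  move=> q0 /andP[th0 th1]; rewrite -(ltr_nat algC) !natrM !natrX natrM => lt.
  have qt0 : 0 < q%:R ^+ t :> algC by rewrite exprn_gt0 ?ltr0n.
  rewrite -(ltr_pM2l qt0); apply: le_lt_trans lt.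
  rewrite [leLHS]mulrA -exprMn [q%:R * _](_ : _ = p%:R * #|K|%:R); last first.
    by field; rewrite pnatr_eq0 -lt0n.
  rewrite [leRHS]mulrC ler_wpM2l ?exprn_ge0 ?mulr_ge0 ?ler0n // [leRHS]mulrC.
  apply: ler_pM => //; last by rewrite -[2]/(1 + 1) lerD2l.
  - by rewrite subr_ge0 ler1n cardG_gt0.
  - by rewrite addr_ge0 ?ler01.
  by rewrite lerBlDr lerDl ler01.
have degree_sq (m : nat) (i : Iirr K) : i != 0 ->
    (forall d : nat, 'chi_i 1%g = d%:R -> (1 < d)%N -> (m <= d)%N) ->
  m%:R ^+ 2 <= 'chi_i 1%g ^+ 2.
  move=> i0 hd; have [d e _] := irr1_nat i.
  by rewrite e lerXn2r ?nnegrE ?ler0n // ler_nat hd // (perfect_irr_degree pK i0 e).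
have nonneg (x y : algC) (a b : nat) : y - x = a%:R / b%:R -> x <= y.
  by move=> e; rewrite -subr_ge0 e divr_ge0 ?ler0n.
have [/existsP[i /eqP d2]|] := boolP [exists i : Iirr K, 'chi_i 1%g == 2].
  have le : (120 <= #|K|)%N by apply: o120; exists i.
  have [t tn lt] := collision_bound_ge (isT : (0 < 120)%N) (isT : (0 < 11)%N) collision_bound120 le.
  (* Here [D] is 4, and 9 in the other case. Each time [lam] is a rational just above the top
     eigenvalue of [[1/2, 1/2], [1/D, 0]], and [theta] is 1/(2 lam). *)
  exists t; apply: (@exists_disjoint_pair _ K t (2 ^+ 2) (8 / 11) (11 / 16)).
  - by rewrite exprn_gt0 ?ltr0n.
  - by move=> j j0; apply: degree_sq.
  - by rewrite divr_ge0 ?ler0n.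
  - by apply: (nonneg _ _ 1 176)%N; field.
  - by apply: (nonneg _ _ 0 1)%N; field.
  - by rewrite -mul2n.
  by apply: exp lt => //; rewrite divr_ge0 ?ler0n //=; apply: (nonneg _ _ 3 11)%N; field.
rewrite negb_exists => /forallP n2.
have [t tn lt] := collision_bound_ge (isT : (0 < 60)%N) (isT : (0 < 3)%N) collision_bound60 o60.
exists t; apply: (@exists_disjoint_pair _ K t (3 ^+ 2) (5 / 6) (3 / 5)).
- by rewrite exprn_gt0 ?ltr0n.
- move=> j j0; apply: degree_sq => // d e d1; rewrite ltn_neqAle d1 andbT.
  by apply: contra (n2 j) => /eqP d2; rewrite e -d2.
- by rewrite divr_ge0 ?ler0n.
- by apply: (nonneg _ _ 1 135)%N; field.
- by apply: (nonneg _ _ 0 1)%N; field.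
- by rewrite -mul2n.
by apply: exp lt => //; rewrite divr_ge0 ?ler0n //=; apply: (nonneg _ _ 1 6)%N; field.
Qed.

End PerfectDegrees.

(** * Splitting off a normal subgroup *)

Section Covering.
Local Open Scope group_scope.

Lemma covers_catr (gT : finGroupType) (N : {group gT}) (s r : seq gT) :
  {subset r <= 'N(N)} -> covers s N -> covers (s ++ r) N.
Proof.
move=> rN [g sg]; have nr : \prod_(x <- r) x \in 'N(N).
  by rewrite big_seq group_prod // => x /rN.
exists (g * \prod_(x <- r) x); apply/subsetP=> _ /lcosetP[h hN ->].
rewrite -mulgA [_ * h]conjgCV mulgA; apply: ordprods_cat (mem_ordprods _).
by apply: (subsetP sg); apply/lcosetP; exists (h ^ (\prod_(x <- r) x)^-1);
   rewrite ?memJ_norm ?groupV.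
Qed.

Variable gT : finGroupType.
Implicit Types (G K : {group gT}) (s : seq gT).

Lemma covers_sub (M N : {set gT}) s : M \subset N -> covers s N -> covers s M.
Proof.
by move=> sMN [g sg]; exists g; apply: subset_trans sg; rewrite mulgS.
Qed.

Definition absorbs G K s :=
  [/\ uniq s, {subset s <= G}, covers s K &
      forall g, g \in G -> exists2 x, x \in g *: K & x \notin s].

Lemma absorbs_covers G K s : K <| G -> absorbs G K s ->
  covers (enum (G / K)) (G / K)^`(1) -> covers (enum G) G^`(1).
Proof.
move=> nKG [us sG cs lo] cq; have nK := normal_norm nKG.
pose r := [seq x <- enum G | x \notin s].
have rG : {subset r <= G} by move=> x; rewrite mem_filter mem_enum => /andP[].
have p : perm_eq (s ++ r) (enum G).
  exact: perm_cat_complement.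
apply: perm_covers p _.
apply: (@covers_sub _ (G^`(1) <*> K)); first exact: joing_subl.
apply: (covers_cat_quotient nKG) => //=; first exact: joing_subr.
  by rewrite join_subG der_sub normal_sub.
rewrite quotientYidr ?(subset_trans (der_sub 1 G)) // quotient_der //.
have [|r' p'] := @perm_uniq_sub _ (enum (G / K)) (map (coset K) r) (enum_uniq _).
  move=> X; rewrite mem_enum => /morphimP[g gN gG ->].
  have [x xg xs] := lo g gG; have [k kK e] := lcosetP xg.
  have xG : x \in G by rewrite e groupM // (subsetP (normal_sub nKG)).
  apply/mapP; exists x; first by rewrite mem_filter xs mem_enum.
  have kN := subsetP (normG K) k kK.
  by rewrite e morphM //= (coset_id kK) mulg1.
rewrite perm_sym in p'; apply: (perm_covers p'); apply: covers_catr cq.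
move=> X Xr'; have : X \in map (coset K) r by rewrite -(perm_mem p') mem_cat Xr' orbT.
case/mapP=> x xr ->; have := mem_quotient K (rG x xr).
by apply: (subsetP (normal_norm (der_normal 1 (G / K)))).
Qed.

Lemma absorbs_perfect G K : K <| G -> K^`(1) = K -> K :!=: 1 ->
  absorbs G K [seq x <- enum K | x != 1].
Proof.
move=> nKG pK K1; split.
- by rewrite filter_uniq ?enum_uniq.
- by move=> x; rewrite mem_filter mem_enum => /andP[_]; apply: (subsetP (normal_sub nKG)).
- have [g cg] := perfect_covers pK K1; exists g; rewrite -ordprods_cons1.
  rewrite -(perm_ordprods (s1 := enum K)) //; apply: uniq_perm.
  + exact: enum_uniq.
  + by rewrite /= mem_filter eqxx filter_uniq ?enum_uniq.
  by move=> x; rewrite mem_enum in_cons mem_filter mem_enum; case: eqP => // ->; rewrite group1.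
move=> g gG; have [gK|gK] := boolP (g \in K).
  exists 1; last by rewrite mem_filter eqxx.
  by apply/lcosetP; exists g^-1; rewrite ?groupV ?mulgV.
exists g; first by apply/lcosetP; exists 1; rewrite ?mulg1.
by rewrite mem_filter mem_enum (negPf gK) andbF.
Qed.

Lemma mem_iota1 p i : (i \in iota 1 p.-1) = (0 < i < p)%N.
Proof. by case: p => [|p]; rewrite mem_iota //=; case: i. Qed.

Lemma expg_neq1 (x : gT) i : i \in iota 1 #[x].-1 -> x ^+ i != 1.
Proof. by rewrite mem_iota1 => /andP[i0 ix]; rewrite -order_dvdn gtnNdvd. Qed.

Lemma expg_iota_inj (x : gT) : {in iota 1 #[x].-1 &, injective (fun i => x ^+ i)}.
Proof.
move=> i j; rewrite !mem_iota1 => /andP[_ hi] /andP[_ hj] /eqP.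
by rewrite eq_expg_mod_order !modn_small // => /eqP.
Qed.

Lemma absorbs_commutator_prime G x y : x \in G -> y \in G ->
    [~ x, y] \in 'Z(G) -> prime #[[~ x, y]] ->
  exists s, absorbs G <[[~ x, y]]> s.
Proof.
set z := [~ x, y] => xG yG zZ pz; set p := #[z] in pz.
have zc g : g \in G -> commute g z by case/centerP: zZ => _ h /h/commute_sym.
have zG : z \in G by case/centerP: zZ.
have zci g i : g \in G -> commute g (z ^+ i) by move=> gG; apply/commuteX/zc.
have zn1 : z != 1 by rewrite -order_gt1 prime_gt1.
(* Equality would make [x] and [y] commute, as [z] is central. *)
have nxy i j : x * z ^+ i != y * z ^+ j.
  apply: contra zn1 => /eqP/(canRL (mulgK _)) e; apply/commgP/commute_sym.
  by rewrite e; apply: commuteM; first (apply: commuteM => //; exact: zci);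
     apply/commuteV/zci.
have zinj (w : gT) : {in iota 1 p.-1 &, injective (fun i => w * z ^+ i)}.
  by move=> i j hi hj /mulgI; apply: expg_iota_inj.
pose s l := [seq x * z ^+ i | i <- l] ++ [seq y * z ^+ i | i <- l].
(* The pair at [i] multiplies to y x z^(2i), or to x y z^(2i), which has one more factor [z]; [j] is
   the number of pairs taken with [x] first. *)
have cov l : exists2 g, g \in G & forall j, (j <= size l)%N -> g * z ^+ j \in ordprods (s l).
  elim: l => [|i l [g gG IH]].
    exists 1 => // j; rewrite leqn0 => /eqP->; rewrite mulg1.
    by apply/ordprodsP; exists [::]; rewrite ?big_nil.
  have ps : perm_eq ([:: x * z ^+ i; y * z ^+ i] ++ s l) (s (i :: l)).
    by rewrite /s /= perm_cons perm_sym; exact/permEl/(perm_catCA _ [:: _]).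
  exists ((y * z ^+ i) * (x * z ^+ i) * g); first by rewrite !groupM ?groupX.
  case=> [|j] lj.
    rewrite mulg1 -(perm_ordprods ps); apply: ordprods_cat; last first.
      by have := IH 0%N isT; rewrite mulg1.
    apply/ordprodsP; exists [:: y * z ^+ i; x * z ^+ i]; last by rewrite big_cons big_seq1.
    by rewrite (perm_catC [:: _] [:: _]).
  rewrite -(perm_ordprods ps).
  have -> : (y * z ^+ i) * (x * z ^+ i) * g * z ^+ j.+1
            = (x * z ^+ i) * (y * z ^+ i) * (g * z ^+ j).
    have e : x * y = y * x * z by rewrite /z commgEl conjgE !mulgA mulgK mulgV mul1g.
    have sw u v : v \in G -> u * z ^+ i * (v * z ^+ i) = u * v * (z ^+ i * z ^+ i).
      by move=> vG; rewrite !mulgA -[u * z ^+ i * v]mulgA -(zci v i vG) !mulgA.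
    have cb : commute (z ^+ i * z ^+ i * (g * z ^+ j)) z by apply: zc; rewrite !groupM ?groupX.
    rewrite !sw // e; transitivity (y * x * (z ^+ i * z ^+ i * (g * z ^+ j) * z)).
      by rewrite expgSr !mulgA.
    by rewrite cb !mulgA.
  apply: ordprods_cat; last by rewrite IH // -ltnS.
  apply/ordprodsP; exists [:: x * z ^+ i; y * z ^+ i] => //.
  by rewrite big_cons big_seq1.
exists (s (iota 1 p.-1)); split.
- rewrite cat_uniq !map_inj_in_uniq ?iota_uniq // andbT /=.
  apply/hasPn=> _ /mapP[j _ ->]; apply/mapP=> -[i _ /eqP].
  by rewrite eq_sym (negPf (nxy _ _)).
- move=> g; rewrite mem_cat => /orP[]/mapP[i _ ->]; exact: groupM (groupX _ _).
- have [g _ h] := cov (iota 1 p.-1); exists g.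
  apply/subsetP=> _ /lcosetP[_ /cyclePmin[j jp ->] ->].
  by apply: h; rewrite size_iota -ltnS prednK // prime_gt0.
have xs i : x * z ^+ i \in s (iota 1 p.-1) -> i != 0%N.
  apply: contraL => /eqP->; rewrite mem_cat negb_or; apply/andP; split.
    by apply/mapP=> -[j /expg_neq1 zj /mulgI/eqP]; rewrite eq_sym (negPf zj).
  by apply/mapP=> -[j _ /eqP]; rewrite (negPf (nxy _ _)).
have ys i : y * z ^+ i \in s (iota 1 p.-1) -> i != 0%N.
  apply: contraL => /eqP->; rewrite mem_cat negb_or; apply/andP; split.
    by apply/mapP=> -[j _ /eqP]; rewrite eq_sym (negPf (nxy _ _)).
  by apply/mapP=> -[j /expg_neq1 zj /mulgI/eqP]; rewrite eq_sym (negPf zj).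
have lo w i : w \in w * z ^+ i *: <[z]>.
  by apply/lcosetP; exists (z ^+ i)^-1; rewrite ?groupV ?mem_cycle ?mulgK.
move=> g gG; have [|gs] := boolP (g \in s (iota 1 p.-1)); last first.
  by exists g => //; apply/lcosetP; exists 1; rewrite ?mulg1.
rewrite mem_cat => /orP[]/mapP[i _ ->]; [exists x | exists y] => //.
  by apply/negP=> h; have := xs 0%N; rewrite mulg1 h => /(_ isT).
by apply/negP=> h; have := ys 0%N; rewrite mulg1 h => /(_ isT).
Qed.

(** For central [z], raising [x] to the power [m] raises the commutator to the power [m], which
    brings its order down to the prime [p]. *)
Lemma absorbs_commutator G x y : x \in G -> y \in G ->
    [~ x, y] \in 'Z(G) -> [~ x, y] != 1 ->
  exists K : {group gT}, [/\ K <| G, K :!=: 1 & exists s, absorbs G K s].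
Proof.
move=> xG yG zZ z1; set z := [~ x, y] in zZ z1.
pose p := pdiv #[z]; have pp : prime p by rewrite pdiv_prime ?order_gt1.
pose m := (#[z] %/ p)%N.
have e : [~ x ^+ m, y] = z ^+ m.
  by rewrite commXg //; case/centerP: zZ => _ h; apply/commute_sym/h.
have oz : #[[~ x ^+ m, y]] = p.
  have d : (m %| #[z])%N by apply/dvdnP; exists p; rewrite mulnC divnK ?pdiv_dvd.
  rewrite e orderXdiv // -[X in (X %/ _)%N](divnK (pdiv_dvd #[z])) -/p -/m mulKn //.
  by rewrite divn_gt0 ?pdiv_gt0 // pdiv_leq // order_gt0.
have zmZ : [~ x ^+ m, y] \in 'Z(G) by rewrite e groupX.
exists <[[~ x ^+ m, y]]>%G; split.
- by apply: sub_center_normal; rewrite cycle_subG.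
- by rewrite -cardG_gt1 -orderE oz prime_gt1.
by apply: absorbs_commutator_prime; rewrite ?groupX ?oz.
Qed.

End Covering.

(** * Moving elements of an abelian normal subgroup *)

Section Insertion.
Local Open Scope group_scope.
Variables (gT : finGroupType) (G K : {group gT}).
Hypotheses (nKG : K <| G) (abK : abelian K).
Implicit Types (S U w : seq gT) (H : {group gT}).

(* v is the product of a word obtained from S by inserting the letters U of K. *)
Definition inserted S U v := exists w,
  [/\ perm_eq w (S ++ U), [seq x <- w | x \notin K] = S & v = \prod_(x <- w) x].

Lemma inserted_ordprods S U v : inserted S U v -> v \in ordprods (S ++ U).
Proof. by case=> w [p _ ->]; apply/ordprodsP; exists w. Qed.

Lemma inserted_nil S : all [pred x | x \notin K] S -> inserted S [::] (\prod_(x <- S) x).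
Proof. by move=> aS; exists S; rewrite cats0; split=> //; apply/all_filterP. Qed.

(** Letters from the abelian group [K] act trivially on [K] by conjugation. *)
Lemma conj_filter k w : k \in K -> {subset w <= G} ->
  k ^ (\prod_(x <- w) x) = k ^ (\prod_(x <- [seq x <- w | x \notin K]) x).
Proof.
elim: w k => [|x w IH] k kK wG //.
have wG' : {subset w <= G} by move=> y yw; rewrite wG // inE yw orbT.
have xN : x \in 'N(K) by rewrite (subsetP (normal_norm nKG)) // wG // mem_head.
rewrite /= big_cons; case: ifPn => xK.
  by rewrite big_cons !conjgM IH // memJ_norm.
rewrite conjgM IH ?memJ_norm //; congr (_ ^ _).
by rewrite negbK in xK; rewrite conjgE (centsP abK k kK x xK) mulKg.
Qed.

(** Moving [k] from before a suffix to its end conjugates it by the product of the suffix; by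
    [conj_filter] only the letters of [S2] in that suffix count. *)
Lemma inserted_cons S1 S2 U v k :
    {subset S1 ++ S2 <= G} -> {subset U <= K} -> k \in K -> inserted (S1 ++ S2) U v ->
  inserted (S1 ++ S2) (k :: U) (v * k ^ \prod_(x <- S2) x).
Proof.
move=> SG UK kK [w [p f ->]]; have [w1 [w2 [ew f1 f2]]] := filter_eq_cat f.
exists (w1 ++ k :: w2); split.
- rewrite -(permPr (permEl (perm_catCA [:: k] (S1 ++ S2) U))) /=.
  rewrite (permPl (permEl (perm_catCA w1 [:: k] w2))) /= perm_cons.
  by rewrite -ew.
- by rewrite filter_cat /= kK f1 f2.
rewrite -f2 -conj_filter // => [|x xw].
  by rewrite ew !big_cat big_cons /= conjgE !mulgA mulgK.
have : x \in w by rewrite ew mem_cat xw orbT.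
rewrite (perm_mem p) mem_cat => /orP[/SG //|/UK]; exact: (subsetP (normal_sub nKG)).
Qed.

(** All powers go after the letters of [S2], except [k ^+ j], which goes before them and so brings
    in a commutator. The value 1 is for [j] outside [js], when no power is moved. *)
Lemma inserted_powers S1 S2 U v k (js : seq nat) (j : nat) :
    {subset S1 ++ S2 <= G} -> {subset U <= K} -> k \in K -> uniq js ->
    inserted (S1 ++ S2) U v ->
  inserted (S1 ++ S2) ([seq k ^+ i | i <- js] ++ U)
    (v * \prod_(i <- js) k ^+ i *
     (if j \in js then [~ k ^+ j, \prod_(x <- S2) x] else 1)).
Proof.
move=> SG UK kK; set t := \prod_(x <- S2) x.
have tN : t \in 'N(K).
  rewrite (subsetP (normal_norm nKG)) // /t big_seq group_prod // => x xS.
  by rewrite SG // mem_cat xS orbT.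
have K_comm a b : a \in K -> b \in K -> a * b = b * a by move=> aK; apply: (centsP abK).
have cK i : [~ k ^+ i, t] \in K.
  by rewrite commgEl groupM ?groupV ?groupX ?memJ_norm ?groupX.
elim: js => [|i js IH] /=; first by rewrite big_nil !mulg1.
case/andP=> ijs /IH {}IH ins.
have UK' : {subset [seq k ^+ i | i <- js] ++ U <= K}.
  by move=> x; rewrite mem_cat => /orP[/mapP[m _ ->]|/UK//]; rewrite groupX.
have PK : \prod_(i <- js) k ^+ i \in K by rewrite group_prod // => m _; rewrite groupX.
have kiK : k ^+ i \in K by rewrite groupX.
rewrite in_cons big_cons; have [eji|nji] := eqVneq j i.
  rewrite eji /=; have := IH ins; rewrite eji (negPf ijs) mulg1 => ins1.
  have := inserted_cons SG UK' kiK ins1; rewrite -/t.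
  congr (inserted _ _ _); rewrite commgEl; move: ((k ^+ i) ^ t) => b.
  by rewrite (K_comm _ _ kiK PK) !mulgA mulgK.
have SG0 : {subset (S1 ++ S2) ++ [::] <= G} by rewrite cats0.
have : inserted ((S1 ++ S2) ++ [::]) ([seq k ^+ i | i <- js] ++ U)
  (v * \prod_(i <- js) k ^+ i * (if j \in js then [~ k ^+ j, t] else 1)).
  by rewrite cats0; apply: IH.
move/(inserted_cons SG0 UK' kiK); rewrite big_nil conjg1 cats0 /=.
congr (inserted _ _ _); rewrite -!mulgA; congr (v * _).
have eK : (if j \in js then [~ k ^+ j, t] else 1) \in K by case: ifP.
by rewrite (K_comm _ _ eK kiK) [RHS]mulgA (K_comm _ _ kiK PK) -mulgA.
Qed.

Lemma half_cover (e e1 h k c u : nat) :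
    2 * e <= k -> 2 * h <= k -> e = e1.+1 -> k <= e1 + c -> c <= u.+1 -> u < h ->
  False.
Proof. lia. Qed.

Lemma line_count p h u : 1 < p -> u < h -> p.-1 + u < h * p.
Proof. by move=> *; nia. Qed.

Section Lines.
Variables (S : seq gT) (p : nat).
Hypothesis SG : {subset S <= G}.
Hypotheses (pp : prime p) (expK : forall k, k \in K -> k ^+ p = 1).
Hypothesis genS : forall g, g \in G -> g \in K \/ exists2 x, x \in S & g \in x *: K.
Hypothesis KG : [~: K, G] = K.

(** The elements of [G] centralising [K] modulo [H] form a group [X]. If all suffix products were in
    [X], so would be every letter, as a quotient of consecutive ones, hence all of [G] by [genS];
    then [K = [~: K, G]] would lie in [H]. *)
Lemma exists_commutator_notin H : H \subset K -> ~~ (K \subset H) ->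
  exists S1 S2, S = S1 ++ S2 /\
    exists2 k, k \in K & [~ k, \prod_(x <- S2) x] \notin H.
Proof.
move=> sHK nKH.
pose X := [set g in G | [forall k in K, [~ k, g] \in H]].
have gX : group_set X.
  apply/group_setP; split.
    by rewrite inE group1; apply/forall_inP=> k _; rewrite commg1 group1.
  move=> g h; rewrite !inE => /andP[gG /forall_inP gH] /andP[hG /forall_inP hH].
  rewrite groupM //; apply/forall_inP=> k kK; rewrite commgMJ groupM ?hH //.
  have aH := gH k kK; rewrite (_ : _ ^ h = [~ k, g] * [~ [~ k, g], h]).
    by rewrite groupM // hH // (subsetP sHK).
  by rewrite [in RHS]commgEl mulKVg.
have [[n lt nX]|all] : (exists2 n, (n <= size S)%N & \prod_(x <- drop n S) x \notin X)
    \/ forall n, (n <= size S)%N -> \prod_(x <- drop n S) x \in X.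
  have [/existsP[n nX]|] := boolP [exists n : 'I_(size S).+1, \prod_(x <- drop n S) x \notin X].
    by left; exists n => //; rewrite -ltnS.
  rewrite negb_exists => /forallP a; right=> n lt.
  by have := a (Ordinal (n:=(size S).+1) (m:=n) lt); rewrite negbK.
  exists (take n S), (drop n S); split; first by rewrite cat_take_drop.
  move: nX; rewrite inE.
  have -> : \prod_(x <- drop n S) x \in G.
    by rewrite big_seq group_prod // => x /mem_drop/SG.
  by rewrite /= negb_forall_in => /exists_inP.
case/negP: nKH; rewrite -KG gen_subG.
have SX x : x \in S -> x \in X.
  move=> xS; pose i := index x S.
  have iS : (i < size S)%N by rewrite index_mem.
  have := all i (ltnW iS); have := all i.+1 iS.
  rewrite (drop_nth 1 iS) big_cons nth_index // => h1 h2.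
  by rewrite -(groupMr x (h1 : _ \in group gX)).
have GX g : g \in G -> g \in X.
  have KX k : k \in K -> k \in X.
    move=> kK; rewrite inE (subsetP (normal_sub nKG)) //; apply/forall_inP=> m mK.
    by rewrite (_ : [~ m, k] = 1) ?group1 //; apply/eqP/commgP; exact: (centsP abK).
  move=> gG; have [/KX//|[x /SX xX /lcosetP[k /KX kX ->]]] := genS gG.
  by rewrite (groupM (xX : x \in group gX) kX).
apply/subsetP=> _ /imset2P[k g kK /GX gX' ->].
by move: gX'; rewrite inE => /andP[_ /forall_inP]; apply.
Qed.

(* The letters U used so far, a union of lines of K minus the identity, realise a
   coset of H.  If some [~ k, t] lies outside H, then adding the line of k and
   moving one of its points k ^+ j to the position with suffix t realises a coset of
   H <*> <[ [~ k, t] ]>; as size U < #|H|, such a k exists outside U. *)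
Lemma line_cover H U v :
    H \subset K -> uniq U -> {subset U <= K} -> 1 \notin U ->
    (forall u i, u \in U -> u ^+ i != 1 -> u ^+ i \in U) ->
    (size U < #|H|)%N -> {in H, forall h, inserted S U (v * h)} ->
  exists U' v', [/\ uniq U', {subset U' <= K}, 1 \notin U' &
                   {in K, forall h, inserted S U' (v' * h)}].
Proof.
have [n] := ubnP (#|K| - #|H|); elim: n => // n IH in H U v *; rewrite ltnS => leH.
move=> sHK uU UK U1 Upow sU insU.
have [KH|nKH] := boolP (K \subset H).
  by exists U, v; split=> // h /(subsetP KH); apply: insU.
have [S1 [S2 [eS [k0 k0K k0H]]]] := exists_commutator_notin sHK nKH.
pose t := \prod_(x <- S2) x; rewrite -/t in k0H.
have tN : t \in 'N(K).
  rewrite (subsetP (normal_norm nKG)) // /t big_seq group_prod // => x xS.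
  by rewrite SG // eS mem_cat xS orbT.
have K_comm a b : a \in K -> b \in K -> a * b = b * a by move=> aK; apply: (centsP abK).
have cK k : k \in K -> [~ k, t] \in K.
  by move=> kK; rewrite commgEl groupM ?groupV ?memJ_norm.
pose E := [set k in K | [~ k, t] \in H].
have gE : group_set E.
  apply/group_setP; split; first by rewrite inE group1 comm1g group1.
  move=> a b; rewrite !inE => /andP[aK aH] /andP[bK bH]; rewrite groupM //.
  by rewrite commMgJ (conjgE _ b) (K_comm _ _ (cK a aK) bK) mulKg groupM.
have sE : E \subset K by apply/subsetP=> a; rewrite inE => /andP[].
have half (A : {group gT}) : A \subset K -> ~~ (K \subset A) -> (2 * #|A| <= #|K|)%N.
  move=> sAK nKA; rewrite -(Lagrange sAK) mulnC leq_mul2l; apply/orP; right.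
  by rewrite indexg_gt1.
have nE : ~~ (K \subset E).
  by apply/negP=> /subsetP/(_ k0 k0K); rewrite inE (negPf k0H) andbF.
(* [E] and [H] are proper subgroups of [K], so each has at most half its elements; as [U] is shorter
   than #|H|, [E] and [U] cannot fill [K]. *)
have [k kK /andP[kE kU]] : exists2 k, k \in K & (k \notin E) && (k \notin U).
  have [/exists_inP[k kK kP]|] := boolP [exists k in K, (k \notin E) && (k \notin U)].
    by exists k.
  rewrite negb_exists_in => /forall_inP no.
  have sKEU : K \subset (E :\ 1) :|: [set x in 1 :: U].
    apply/subsetP=> x xK; have := no x xK; rewrite negb_and !negbK in_setU in_setD1.
    rewrite [x \in [set _ in _]]inE in_cons.
    by case: (x == 1) => //= /orP[->//|->]; rewrite orbT.
  have cU : (#|[set x in 1%g :: U]| <= (size U).+1)%N by rewrite cardsE; exact: card_size.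
  have le := leq_trans (subset_leq_card sKEU) (leq_card_setU _ _).
  have hE := half (group gE) sE nE; have hH := half H sHK nKH.
  have eE : #|E| = #|E^#|.+1 by rewrite (cardsD1 1 E) (group1 (group gE)).
  by case: (half_cover hE hH eE le cU sU).
pose c := [~ k, t]; have cKk : c \in K by exact: cK.
have cH : c \notin H by move: kE; rewrite inE kK.
have c1 : c != 1 by apply: contraNneq cH => ->.
have ord a : a \in K -> a != 1 -> #[a] = p.
  move=> aK a1; apply/nt_prime_order => //; exact: expK.
have oc := ord c cKk c1.
have k1 : k != 1 by apply: contraNneq c1 => e; rewrite /c e comm1g.
have ok := ord k kK k1.
have TI : H :&: <[c]> = 1.
  by rewrite setIC prime_TIg ?cycle_subG // -orderE oc.
have sHc : H <*> <[c]> \subset K by rewrite join_subG sHK cycle_subG.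
have eHc : H <*> <[c]> = H * <[c]>.
  by rewrite comm_joingE //; apply: centC; apply: (sub_abelian_cent2 abK); rewrite ?cycle_subG.
have cardHc : #|H <*> <[c]>| = (#|H| * p)%N by rewrite eHc TI_cardMg // -orderE oc.
have H0 := cardG_gt0 H; have p1 := prime_gt1 pp.
pose L := [seq k ^+ i | i <- iota 1 p.-1].
have kX i : i \in iota 1 p.-1 -> k ^+ i != 1 by rewrite -ok; apply: expg_neq1.
(* By primality of [p], [k] is a power of each nontrivial power of itself, so a line meeting [U]
   would put [k] in [U]. *)
have LU u : u \in L -> u \notin U.
  case/mapP=> i /kX ki1 ->; apply: contra kU => kiU.
  have : k \in <[k ^+ i]>.
    have : <[k ^+ i]> == <[k]>.
      rewrite eqEcard cycleX -!orderE ok.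
      by rewrite (ord _ _ ki1) ?groupX /=.
    by move/eqP->; apply: cycle_id.
  by case/cycleP=> m e; rewrite e Upow // -e.
apply: (IH (H <*> <[c]>)%G (L ++ U) (v * \prod_(i <- iota 1 p.-1) k ^+ i)) => //.
- apply: leq_trans leH; apply: ltn_sub2l; rewrite /= ?cardHc.
    by apply: leq_trans (half H sHK nKH); rewrite mul2n -addnn -addn1 leq_add2l.
  by rewrite ltn_Pmulr.
- rewrite cat_uniq uU andbT map_inj_in_uniq ?iota_uniq /=; last first.
    by rewrite -ok; apply: expg_iota_inj.
  by apply/hasPn=> u; apply: contraL => /LU.
- move=> u; rewrite mem_cat => /orP[/mapP[i _ ->]|/UK//]; exact: groupX.
- rewrite mem_cat negb_or U1 andbT; apply/mapP=> -[i /kX ki /eqP].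
  by rewrite eq_sym (negPf ki).
- move=> u i; rewrite !mem_cat => /orP[/mapP[j _ ->]|/Upow h /h->]; last by rewrite orbT.
  rewrite -expgM -expg_mod_order ok => n1; apply/orP; left; apply: map_f.
  rewrite mem_iota1 (@ltn_pmod _ p) ?(prime_gt0 pp) // andbT.
  by rewrite lt0n; apply: contra n1 => /eqP->.
- by rewrite size_cat size_map size_iota /= cardHc line_count.
move=> h /=; rewrite eHc => /mulsgP[a _ aH /cyclePmin[j jp ->] ->].
rewrite oc in jp; have aK := subsetP sHK a aH.
have PK : \prod_(i <- iota 1 p.-1) k ^+ i \in K by rewrite group_prod // => m _; rewrite groupX.
have SG' : {subset S1 ++ S2 <= G} by rewrite -eS.
have ins0 : inserted (S1 ++ S2) U (v * a) by rewrite -eS; apply: insU.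
have := inserted_powers j SG' UK kK (iota_uniq 1 p.-1) ins0; rewrite -eS -/t.
congr (inserted _ _ _); rewrite -!mulgA; congr (v * _).
rewrite !mulgA (K_comm a _ aK PK); congr (_ * _).
have cX : [~ k ^+ j, t] = c ^+ j by apply: commXg; apply: K_comm.
rewrite mem_iota1 jp andbT -cX; case: ifPn => //.
by rewrite -eqn0Ngt => /eqP->; rewrite comm1g.
Qed.

End Lines.

End Insertion.

(** * The theorem of Denes and Hermann *)

Section DenesHermann.
Local Open Scope group_scope.
Variable gT : finGroupType.
Implicit Types (G K M : {group gT}) (s : seq gT).

Lemma absorbs_abelian G K p : K <| G -> abelian K -> prime p ->
    (forall k, k \in K -> k ^+ p = 1) -> [~: K, G] = K -> K :!=: 1 ->
  exists s, absorbs G K s.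
Proof.
move=> nKG abK pp expK KG K1.
pose S := [seq x <- enum G | (x \notin K) && (repr (x *: K) == x)].
have SG : {subset S <= G} by move=> x; rewrite mem_filter mem_enum => /andP[].
have SK : all [pred x | x \notin K] S.
  by apply/allP=> x; rewrite mem_filter => /andP[/andP[]].
have KsG := subsetP (normal_sub nKG).
have genS g : g \in G -> g \in K \/ exists2 x, x \in S & g \in x *: K.
  move=> gG; have [|gK] := boolP (g \in K); [by left | right].
  have rg : repr (g *: K) \in g *: K by apply: mem_repr (lcoset_refl K g).
  have er := lcoset_eqP rg; exists (repr (g *: K)); last by rewrite er lcoset_refl.
  have [k kK ek] := lcosetP rg.
  rewrite mem_filter mem_enum er eqxx andbT ek groupMr // gK groupM //; exact: KsG.
have [|||||||U [v [uU UK U1 ins]]] :=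
    line_cover nKG abK SG pp expK genS KG (H := 1%G) (U := [::]) (v := \prod_(x <- S) x).
- exact: sub1G.
- by [].
- by [].
- by [].
- by [].
- by rewrite cards1.
- by move=> h /set1P->; rewrite mulg1; apply: inserted_nil.
exists (S ++ U); split.
- rewrite cat_uniq filter_uniq ?enum_uniq // uU andbT.
  by apply/hasPn=> x /UK xK; rewrite mem_filter xK.
- by move=> x; rewrite mem_cat => /orP[/SG//|/UK/KsG].
- exists v; apply/subsetP=> _ /lcosetP[h hK ->].
  exact: inserted_ordprods (ins h hK).
move=> g gG; have [gK|gK] := boolP (g \in K).
  exists 1; last by rewrite mem_cat negb_or U1 mem_filter group1.
  by apply/lcosetP; exists g^-1; rewrite ?groupV ?mulgV.
have [gS|gS] := boolP (g \in S); last first.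
  exists g; first exact: lcoset_refl.
  by rewrite mem_cat negb_or gS; apply: contra gK => /UK.
have /trivgPn[k kK k1] := K1.
have gk : g * k \in g *: K by rewrite mem_lcoset mulKg.
exists (g * k) => //; rewrite mem_cat negb_or; apply/andP; split.
  rewrite mem_filter (lcoset_eqP gk); move: gS; rewrite mem_filter => /andP[/andP[_ /eqP->] _].
  by rewrite negb_and negb_and -(inj_eq (mulgI g^-1)) mulVg mulKg eq_sym k1 orbT.
by apply: contra gK => /UK; rewrite groupMr.
Qed.

(** Take [K] minimal among noncentral abelian normal subgroups. The commutator hypothesis makes
    [[~: K, G]] noncentral, hence equal to [K]. If the kernel [Om] of the p-th power map were
    central, then, its proper image [Pw] being central too, [[~ k, g] ^+ p = [~ k ^+ p, g] = 1], and
    [K = [~: K, G]] would lie in [Om]. *)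
Lemma exists_minimal_noncentral G M : M <| G -> abelian M -> ~~ (M \subset 'Z(G)) ->
    (forall x y, x \in G -> y \in G -> [~ x, y] \in 'Z(G) -> [~ x, y] = 1) ->
  exists K : {group gT}, exists2 p, prime p &
    [/\ K <| G, abelian K, forall k, k \in K -> k ^+ p = 1, [~: K, G] = K & K :!=: 1].
Proof.
move=> nMG abM nMZ noc.
pose P (A : {set gT}) := [&& A <| G, abelian A & ~~ (A \subset 'Z(G))].
have [K minK _] : {K : {group gT} | [min K | P K] & K \subset M}.
  by apply: mingroup_exists; rewrite /P nMG abM.
have {minK}[/and3P[nKG abK nKZ] minK] := mingroupP minK.
have KsG := subsetP (normal_sub nKG); have nK := normal_norm nKG.
have K_comm a b : a \in K -> b \in K -> commute a b by move=> aK; apply: (centsP abK).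
have Kmin (A : {group gT}) : A <| G -> A \subset K -> ~~ (A \subset 'Z(G)) -> A :=: K.
  by move=> nA sAK nAZ; apply: minK => //; rewrite /P nA nAZ (abelianS sAK abK).
have KG : [~: K, G] = K.
  apply: (Kmin [~: K, G]%G); rewrite ?commg_subl //.
    by rewrite /normal commg_normr andbT (subset_trans _ (normal_sub nKG)) ?commg_subl.
  apply: contra nKZ => sKGZ; apply/subsetP=> k kK; apply/centerP; split; first exact: KsG.
  move=> g gG; apply/commgP/eqP; apply: noc => //; first exact: KsG.
  by apply: (subsetP sKGZ); rewrite mem_commg.
have K1 : K :!=: 1 by apply: contraNneq nKZ => ->; apply: sub1G.
pose p := pdiv #|K|.
have pp : prime p by rewrite pdiv_prime ?cardG_gt1.
exists K, p => //; split=> //.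
have powM a b : a \in K -> b \in K -> (a * b) ^+ p = a ^+ p * b ^+ p.
  by move=> aK bK; apply/expgMn/K_comm.
pose Om := [set k in K | k ^+ p == 1].
have gOm : group_set Om.
  apply/group_setP; split; first by rewrite inE group1 expg1n eqxx.
  move=> a b; rewrite !inE => /andP[aK /eqP ea] /andP[bK /eqP eb].
  by rewrite groupM // powM // ea eb mulg1 eqxx.
have sOm : Om \subset K by apply/subsetP=> a; rewrite inE => /andP[].
have nOm : Om <| G.
  rewrite /normal (subset_trans sOm (normal_sub nKG)).
  apply/subsetP=> g gG; rewrite inE; apply/subsetP=> _ /imsetP[k kO ->].
  move: kO; rewrite !inE => /andP[kK /eqP ek].
  by rewrite -conjXg ek conj1g eqxx memJ_norm ?(subsetP nK) ?kK.
have [OmZ|OmZ] := boolP (Om \subset 'Z(G)); last first.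
  move=> k; rewrite -(Kmin (group gOm) nOm sOm OmZ) inE => /andP[_ /eqP//].
pose Pw := [set k ^+ p | k in K].
have gPw : group_set Pw.
  apply/group_setP; split; first by apply/imsetP; exists 1; rewrite ?expg1n.
  move=> _ _ /imsetP[a aK ->] /imsetP[b bK ->]; rewrite -powM //.
  by apply: imset_f; rewrite groupM.
have sPw : Pw \subset K by apply/subsetP=> _ /imsetP[a aK ->]; rewrite groupX.
have nPw : Pw <| G.
  rewrite /normal (subset_trans sPw (normal_sub nKG)).
  apply/subsetP=> g gG; rewrite inE; apply/subsetP=> _ /imsetP[_ /imsetP[k kK ->] ->].
  by rewrite conjXg; apply: imset_f; rewrite memJ_norm ?(subsetP nK).
have PwZ : Pw \subset 'Z(G).
  apply/negPn/negP=> PwZ; have ePw : Pw = K := Kmin (group gPw) nPw sPw PwZ.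
  have [a aK oa] := Cauchy pp (pdiv_dvd #|K|).
  have /imset_injP inj : #|Pw| == #|K| by rewrite ePw.
  have := inj a 1 aK (group1 K); rewrite expg1n -{1}oa expg_order => /(_ erefl) a1.
  by move: oa pp; rewrite a1 order1 => <-.
case/negP: nKZ; rewrite -KG gen_subG; apply/subsetP=> _ /imset2P[k g kK gG ->].
have cK : [~ k, g] \in K by rewrite -KG mem_commg.
apply: (subsetP OmZ); rewrite inE cK -commXg; last exact: K_comm.
apply/commgP; have : k ^+ p \in 'Z(G) by apply: (subsetP PwZ); apply: imset_f.
by case/centerP=> _ h; apply: h.
Qed.

Lemma exists_absorbs G : ~~ abelian G ->
  exists K : {group gT}, [/\ K <| G, K :!=: 1 & exists s, absorbs G K s].
Proof.
move=> nabG.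
have [/exists_inP[x xG /exists_inP[y yG /andP[zZ z1]]]|] :=
    boolP [exists x in G, exists y in G, ([~ x, y] \in 'Z(G)) && ([~ x, y] != 1)].
  exact: absorbs_commutator zZ z1.
rewrite negb_exists_in => /forall_inP noc0.
have noc x y : x \in G -> y \in G -> [~ x, y] \in 'Z(G) -> [~ x, y] = 1.
  move=> xG yG zZ; have := noc0 x xG; rewrite negb_exists_in => /forall_inP/(_ y yG).
  by rewrite zZ negbK => /eqP.
have [solG|] := boolP (solvable G); last first.
  rewrite negb_forall_in => /exists_inP[H]; rewrite subsetI => /andP[sHG sHH] H1.
  (* Failure of solvability provides a nontrivial [H] contained in its own derived subgroup; its
     normal closure in [G] is perfect. *)
  pose K := <<class_support H G>>%G.
  have sHK : H \subset K by rewrite sub_gen // sub_class_support.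
  have nKG : K <| G.
    by rewrite /normal gen_subG class_support_subG // norms_gen // class_support_norm.
  exists K; split=> //.
    by apply: contraNneq H1 => K1; rewrite -subG1 -K1.
  exists [seq x <- enum K | x != 1]; apply: absorbs_perfect => //; last first.
    by apply: contraNneq H1 => K1; rewrite -subG1 -K1.
  apply/eqP; rewrite eqEsubset der_sub gen_subG /=.
  apply/subsetP=> _ /imset2P[h g hH gG ->].
  have gN : g \in 'N(K^`(1)).
    by rewrite (subsetP (normal_norm (char_normal_trans (der_char 1 K) nKG))).
  by rewrite memJ_norm // (subsetP (subset_trans sHH _) h hH) // commgSS.
pose Z := 'Z(G)%G; have nZG : Z <| G := center_normal G.
have solQ : solvable (G / Z) by apply: quotient_sol.
have Q1 : (G / Z)%G :!=: 1.
  apply: contra nabG => /eqP Q1; have sGZ : G \subset 'Z(G).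
    by rewrite -quotient_sub1 ?normal_norm // Q1.
  exact: abelianS sGZ (center_abelian G).
(* The preimage [M] of a minimal normal subgroup of [G / Z] has its commutators in [Z]; by [noc]
   they are trivial, so [M] is abelian, yet not central. *)
have [Mq minM sMG] := minnormal_exists Q1 (normG (G / Z)).
have [nMq Mq1 /abelem_abelian abMq] := minnormal_solvable minM sMG solQ.
have nMqQ : Mq <| (G / Z) by rewrite /normal sMG.
have [M eM sZM nMG] := inv_quotientN nZG nMqQ.
have abM : abelian M.
  apply/centsP=> x xM y yM; apply/commgP/eqP.
  have MG := subsetP (normal_sub nMG); apply: noc; rewrite ?MG //.
  have sM'Z : M^`(1) \subset Z.
    apply: der1_min; last by rewrite -eM.
    exact: subset_trans (normal_sub nMG) (normal_norm nZG).
  by apply: (subsetP sM'Z); rewrite mem_commg.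
have nMZ : ~~ (M \subset 'Z(G)).
  by apply: contra Mq1 => sMZ; rewrite eM; apply/eqP/quotientS1.
have [K [p pp [nKG abK expK KG K1]]] := exists_minimal_noncentral nMG abM nMZ noc.
by exists K; split=> //; apply: absorbs_abelian expK KG K1.
Qed.

End DenesHermann.

Theorem covers_der1 (gT : finGroupType) (G : {group gT}) : covers (enum G) G^`(1)%g.
Proof.
have [n] := ubnP #|G|; elim: n => // n IH in gT G *; rewrite ltnS => leGn.
have [/derG1P ->|nabG] := boolP (abelian G).
  exists (\prod_(x <- enum G) x)%g; rewrite mulg1 sub1set; exact: mem_ordprods.
have [K [nKG K1 [s abs]]] := exists_absorbs nabG.
apply: (absorbs_covers nKG abs); apply: (IH _ (G / K)%G).
by apply: leq_trans leGn; rewrite ltn_quotient // normal_sub.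
Qed.

(** * Loops *)

Section LoopQuotient.
Local Open Scope group_scope.
Variables (Q : finLoopType) (N : {set Q}).
Hypotheses (nN : normal_subloop N) (gN : group_quotient N).
Implicit Types (x y z : Q) (X Y : {set Q}).

Lemma loop_cosetA x y z :
  loop_coset ((x * y) * z)%L N = loop_coset (x * (y * z))%L N.
Proof. by apply/eqP; rewrite (loop_cosetP nN); apply: (elimT (group_quotientP nN) gN). Qed.

Lemma mem_loop_cosets x : loop_coset x N \in loop_cosets N.
Proof. exact: imset_f. Qed.

(* Extended by the identity outside the cosets, so that Q / N becomes a group of
   permutations of {set Q}. *)
Definition right_translation x X : {set Q} :=
  if X \in loop_cosets N then Defs.coset_mul X (loop_coset x N) else X.

Lemma right_translationE x y : right_translation x (loop_coset y N) = loop_coset (y * x)%L N.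
Proof. by rewrite /right_translation mem_loop_cosets loop_cosetM. Qed.

Lemma right_translation_inj x : injective (right_translation x).
Proof.
have clos X : X \in loop_cosets N -> right_translation x X \in loop_cosets N.
  by case/imsetP=> y _ ->; rewrite right_translationE mem_loop_cosets.
have out X : X \notin loop_cosets N -> right_translation x X = X.
  by rewrite /right_translation => /negPf->.
move=> X Y; have [Xc|Xc] := boolP (X \in loop_cosets N); last first.
  rewrite (out X) //; have [/clos Yc e|/out->//] := boolP (Y \in loop_cosets N).
  by rewrite e Yc in Xc.
have [|Yc] := boolP (Y \in loop_cosets N); last first.
  by rewrite (out Y Yc) => e; rewrite -e clos in Yc.
case/imsetP: Xc => a _ -> /imsetP[b _ ->]; rewrite !right_translationE.
pose r := (Lmul x)^-1 1%L; have xr : (x * r)%L = 1%L by rewrite LmulVK.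
move/(congr1 (right_translation r)); rewrite !right_translationE !loop_cosetA xr.
by rewrite !loop_mul1r.
Qed.

Definition quotient_perm x : {perm {set Q}} := perm (@right_translation_inj x).

Lemma quotient_perm_coset x y :
  (quotient_perm x == quotient_perm y) = (y \in loop_coset x N).
Proof.
rewrite mem_loop_coset -(loop_cosetP nN) eq_sym; apply/eqP/eqP => [e|e].
  have := congr1 (fun s : {perm {set Q}} => s (loop_coset 1%L N)) e.
  by rewrite !permE !right_translationE !loop_mul1l.
by apply/permP=> X; rewrite !permE /right_translation e.
Qed.

Lemma quotient_permM x y : quotient_perm (x * y)%L = quotient_perm x * quotient_perm y.
Proof.
apply/permP=> X; rewrite permM !permE; have [|Xc] := boolP (X \in loop_cosets N).
  by case/imsetP=> a _ ->; rewrite !right_translationE loop_cosetA.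
by rewrite /right_translation !(negPf Xc).
Qed.

Lemma quotient_perm1 : quotient_perm 1%L = 1.
Proof. by apply: (mulgI (quotient_perm 1%L)); rewrite mulg1 -quotient_permM loop_mul1l. Qed.

Lemma quotient_perm_ldiv x y :
  quotient_perm ((Lmul x)^-1 y) = (quotient_perm x)^-1 * quotient_perm y.
Proof. by apply: (mulgI (quotient_perm x)); rewrite -quotient_permM LmulVK mulKVg. Qed.

Lemma quotient_perm_rdiv x y :
  quotient_perm ((Rmul x)^-1 y) = quotient_perm y * (quotient_perm x)^-1.
Proof. by apply: (mulIg (quotient_perm x)); rewrite -quotient_permM RmulVK mulgKV. Qed.

Lemma quotient_perm_group_set : group_set [set quotient_perm x | x : Q].
Proof.
apply/group_setP; split; first by rewrite -quotient_perm1 imset_f.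
by move=> _ _ /imsetP[x _ ->] /imsetP[y _ ->]; rewrite -quotient_permM imset_f.
Qed.
Canonical quotient_perm_group := group quotient_perm_group_set.

Lemma quotient_permG x : quotient_perm x \in quotient_perm_group.
Proof. exact: imset_f. Qed.

Lemma quotient_perm_bracket (t : bracketing Q) :
  quotient_perm (bracket_value t) = \prod_(x <- factors t) quotient_perm x.
Proof.
elim: t => [x|t1 IH1 t2 IH2] /=; first by rewrite big_seq1.
by rewrite quotient_permM IH1 IH2 big_cat.
Qed.

(** The preimage [M] of the derived group is a normal subloop with Abelian quotient, so it contains
    the derived subloop. *)
Lemma derived_subloop_quotient_perm x :
  x \in derived_subloop Q -> quotient_perm x \in quotient_perm_group^`(1).
Proof.
set G := quotient_perm_group; pose M := [set x | quotient_perm x \in G^`(1)].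
have inM u : (u \in M) = (quotient_perm u \in G^`(1)) by rewrite inE.
have nM : normal_subloop M.
  apply/(normal_subloopP); split.
  - apply/subloopP; split=> [|u v|u v|u v]; rewrite !inM ?quotient_perm1 ?group1 //.
    + by rewrite quotient_permM; apply: groupM.
    + by rewrite quotient_perm_ldiv => uM vM; rewrite groupM ?groupV.
    + by rewrite quotient_perm_rdiv => uM vM; rewrite groupM ?groupV.
  - move=> u v w; rewrite !inM /innerL quotient_perm_ldiv !LmulE !quotient_permM.
    by rewrite [quotient_perm v * (_ * _)]mulgA mulKg.
  - move=> u v w; rewrite !inM /innerR quotient_perm_rdiv !RmulE !quotient_permM.
    by rewrite -[_ * quotient_perm u * quotient_perm v]mulgA mulgK.
  move=> u w; rewrite !inM /innerT quotient_perm_rdiv LmulE quotient_permM => wM.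
  rewrite (_ : _ * _ = quotient_perm w ^ (quotient_perm u)^-1).
    rewrite memJ_norm ?groupV //.
    by apply: (subsetP (normal_norm (der_normal 1 G))); apply: quotient_permG.
  by rewrite conjgE invgK mulgA.
have aM : abelian_quotient M.
  apply/(abelian_quotientP nM); split=> [u v w|u v]; rewrite inM quotient_perm_ldiv !quotient_permM.
    by rewrite [quotient_perm u * (_ * _)]mulgA mulVg group1.
  rewrite invMg -mulgA; exact: mem_commg (quotient_permG _) (quotient_permG _).
have [_ _ sm] := derived_subloop_smallest Q.
by move/(subsetP (sm M nM aM)); rewrite inM.
Qed.

(** Any ordering is realised by its right-nested bracketing; [0 < k] guarantees at least one
    factor. *)
Lemma quotient_full_product k g : (0 < k)%N ->
    g \in ordprods [seq quotient_perm x | x <- flatten (nseq k (enum Q))] ->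
  exists2 p, full_product k p & quotient_perm p = g.
Proof.
move=> k0 /ordprodsP[_ /perm_eq_map_lift[s ps ->] ->].
have cs x : count_mem x s = k.
  rewrite (seq.permP ps) count_flatten map_nseq sumn_nseq.
  by rewrite count_uniq_mem ?enum_uniq // mem_enum mul1n.
have [t ft] : exists t, factors t = s.
  have : s != [::] by apply: contraTneq k0 => s0; rewrite -(cs 1%L) s0.
  case: s {ps cs} => // x s _; elim: s x => [|y s IH] x; first by exists (Factor x).
  by have [t ft] := IH y; exists (Prod (Factor x) t); rewrite /= ft.
exists (bracket_value t); first by exists t; rewrite ft.
by rewrite quotient_perm_bracket ft big_map.
Qed.

(** The images contain a copy of the whole group, so their products fill a coset of its derived
    group. A full product over one point of that coset lies in the same coset of the derived subloop
    as [y], so the image of [y] is reached as well. *)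
Lemma full_products_meet_coset k x y : (0 < k)%N ->
    (forall p, full_product k p -> p \in loop_coset x (derived_subloop Q)) ->
    y \in loop_coset x (derived_subloop Q) ->
  exists2 p, full_product k p & p \in loop_coset y N.
Proof.
move=> k0 Px yx; set G := quotient_perm_group.
set s := [seq quotient_perm x | x <- flatten (nseq k (enum Q))].
have [|r ps] := @perm_uniq_sub _ (enum G) s (enum_uniq _).
  move=> g; rewrite mem_enum => /imsetP[z _ ->]; apply: map_f.
  by case: k k0 {Px s} => // k _; rewrite /= mem_cat mem_enum.
rewrite perm_sym in ps.
have [g cg] : covers s G^`(1).
  apply: (perm_covers ps); apply: covers_catr (covers_der1 G) => g gr.
  apply: (subsetP (normal_norm (der_normal 1 G))).
  have : g \in s by rewrite -(perm_mem ps) mem_cat gr orbT.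
  by case/mapP=> z _ ->; apply: quotient_permG.
have [p Pp ep] : exists2 p, full_product k p & quotient_perm p = g.
  apply: quotient_full_product => //; apply: (subsetP cg).
  by apply/lcosetP; exists 1; rewrite ?mulg1.
have : quotient_perm y \in g *: G^`(1).
  case/imsetP: yx (Px p Pp) => a aD -> /imsetP[b bD eb].
  rewrite mem_lcoset -ep eb !quotient_permM invMg -mulgA mulKg.
  by rewrite groupM ?groupV ?derived_subloop_quotient_perm.
move/(subsetP cg)/(quotient_full_product k0)=> [q Pq eq].
by exists q => //; rewrite -quotient_perm_coset eq.
Qed.

End LoopQuotient.

Theorem theorem5 (Q : finLoopType) :
  (forall x : Q,
     (forall p, full_product 1%N p -> p \in loop_coset x (derived_subloop Q)) ->
     (forall y, y \in loop_coset x (derived_subloop Q) ->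
        exists2 p, full_product 1%N p
                 & p \in loop_coset y (associator_subloop Q)) /\
     (forall C, C \in loop_cosets (associator_subloop Q) ->
        C \subset loop_coset x (derived_subloop Q) ->
        exists2 p, full_product 1%N p & p \in C)) /\
  ((forall p : Q, full_product 1%N p -> p \in derived_subloop Q) ->
     exists2 p : Q, full_product 1%N p & p \in associator_subloop Q) /\
  (forall k : nat, (1 <= k)%N ->
     forall D, D \in loop_cosets (derived_subloop Q) ->
     (forall p, full_product k p -> p \in D) ->
     forall C, C \in loop_cosets (associator_subloop Q) ->
     C \subset D ->
     exists2 p, full_product k p & p \in C).
Proof.
have [nA gA _] := associator_subloop_smallest Q.
have [nD _ _] := derived_subloop_smallest Q.
have A1 : (1 \in associator_subloop Q)%L by case/and3P: nA => /andP[].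
have D1 : (1 \in derived_subloop Q)%L by case/and3P: nD => /andP[].
have main k x y := @full_products_meet_coset Q _ nA gA k x y.
have mainC k x C : (0 < k)%N ->
    (forall p, full_product k p -> p \in loop_coset x (derived_subloop Q)) ->
    C \in loop_cosets (associator_subloop Q) -> C \subset loop_coset x (derived_subloop Q) ->
  exists2 p, full_product k p & p \in C.
  move=> k0 Px /imsetP[y _ ->] /subsetP sC; apply: main Px _ => //.
  by apply: sC; apply/imsetP; exists 1%L; rewrite ?loop_mul1r.
split=> [x Px|].
  by split=> [y|C]; [exact: (main 1%N x y isT Px) | exact: (mainC 1%N x C isT Px)].
split=> [P1|k k0 D /imsetP[x _ ->]]; last by move=> Px C; exact: (mainC k x C k0 Px).
have [] := main 1%N 1%L 1%L; rewrite ?loop_coset1 // => p Pp pA.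
by exists p.
Qed.
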